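(* Let $\beta$ be a real number with $0<\beta\le1/2$, and let $k=k(n)$ be positive integers with $k=\beta n+o(n)$. Then $$\operatorname{Hdepth}_1M(n,k)=(1-\gamma)n+o(n),\qquad n\to\infty,$$ where $\gamma$ is the smallest nonnegative solution of the equation $$\frac{(\alpha+\gamma)^{\alpha+\gamma}(\alpha+\beta)^{\alpha+\beta}(1-\alpha-\beta-\gamma)^{1-\alpha-\beta-\gamma}}{\alpha^{\alpha}\beta^{\beta}\gamma^{\gamma}(1-\beta)^{1-\beta}(1-\gamma)^{1-\gamma}}=1,$$ with $$\alpha=\frac14\Big(1-2\beta-2\gamma+\sqrt{(1-2\beta-2\gamma)^2-8\beta\gamma}\Big).$$
   Context: $K$ is a field, $R=K[X_1,\dots,X_n]$ with the standard grading ($\deg X_i=1$). $M(n,k)$ is the $k$-th syzygy module of $K=R/(X_1,\dots,X_n)$ in the Koszul complex: the image of $\partial:\bigwedge^kR^n\to\bigwedge^{k-1}R^n$, $\partial(e_{i_1}\wedge\dots\wedge e_{i_k})=\sum_{r=1}^k(-1)^{r+1}X_{i_r}e_{i_1}\wedge\dots\widehat{e_{i_r}}\dots\wedge e_{i_k}$, where $e_{i_1}\wedge\dots\wedge e_{i_k}$ has degree $k$. A graded retract of $R$ is a $K$-subalgebra generated by a set of linear forms. A Hilbert decomposition of $M$ is a finite family $(S_i,s_i)$, $s_i\in\mathbb{Z}$, $S_i$ graded retracts, with $M\cong\bigoplus_iS_i(-s_i)$ as graded $K$-vector spaces; its depth is $\min_i\dim S_i$; $\operatorname{Hdepth}_1M$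 is the maximal depth of such a decomposition. The convention $0^0=1$ is used. *)

(* Defs.v *)
From Stdlib Require Import Reals.
From HB Require Import structures.
From mathcomp Require Import all_boot all_order all_algebra.
From mathcomp Require Import mpoly.
Set Implicit Arguments. Unset Strict Implicit. Unset Printing Implicit Defensive.
Import GRing.Theory.

Section RealDefs.
Local Open Scope R_scope.

(* x^x with the convention 0^0 = 1 (x >= 0 intended) *)
Definition xpx (x : R) : R := if Req_EM_T x 0 then 1 else Rpower x x.

Definition alpha_of (b g : R) : R :=
  / 4 * (1 - 2 * b - 2 * g + sqrt ((1 - 2 * b - 2 * g) ^ 2 - 8 * b * g)).

(* g is a nonnegative solution of the equation of Theorem 4.5 (all
   quantities under the square root / the x^x's are in the domain) *)
Definition is_solution (b g : R) : Prop :=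
  let a := alpha_of b g in
  0 <= g /\ 0 <= (1 - 2 * b - 2 * g) ^ 2 - 8 * b * g /\
  0 <= a /\ 0 <= 1 - a - b - g /\ 0 <= 1 - g /\
  xpx (a + g) * xpx (a + b) * xpx (1 - a - b - g) /
   (xpx a * xpx b * xpx g * xpx (1 - b) * xpx (1 - g)) = 1.

Definition smallest_solution (b g : R) : Prop :=
  is_solution b g /\ forall g', is_solution b g' -> g <= g'.

Definition lin_asym (k : nat -> nat) (b : R) : Prop :=
  forall eps, 0 < eps -> exists N : nat, forall n : nat, (N <= n)%nat ->
    Rabs (INR (k n) - b * INR n) <= eps * INR n.

End RealDefs.

Local Open Scope ring_scope.

Section Koszul.
Variables (K : fieldType) (n : nat).

(* R = K[X_1..X_n];  /\^j R^n is represented by functions on subsets of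
   'I_n (the basis vector e_J sits at the set J, #|J| = j). *)
Definition wedge := {ffun {set 'I_n} -> {mpoly K[n]}}.

(* Koszul differential  /\^k R^n -> /\^(k-1) R^n :
   (d f)_J = sum_{i notin J} (-1)^{#{j in J | j < i}} X_i f_{J u {i}}
   for #|J| = k-1 (only the values of f on k-subsets are used). *)
Definition koszul_d (k : nat) (f : wedge) : wedge :=
  [ffun J : {set 'I_n} =>
     if #|J| == k.-1 then
       \sum_(i < n | i \notin J)
          ((-1) ^+ #|[set j in J | (j < i)%N]| * 'X_i * f (i |: J))
     else 0].

Definition inM (k : nat) (x : wedge) : Prop := exists f : wedge, x = koszul_d k f.

Definition homog_of (p : {mpoly K[n]}) (e : int) : Prop :=
  p = 0 \/ exists2 j : nat, e = j%:Z & p \is j.-homog.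

(* degree-d part of M(n,k); e_J has degree k-1 *)
Definition inM_deg (k : nat) (d : int) (x : wedge) : Prop :=
  inM k x /\ forall J, homog_of (x J) (d - (k.-1)%:Z).

(* Graded retract generated by the linear forms given by the rows of A:
   row r is the linear form  sum_j A r j X_j. *)
Definition lin_form (m : nat) (A : 'M[K]_(m, n)) (r : 'I_m) : {mpoly K[n]} :=
  \sum_(j < n) A r j *: 'X_j.

(* degree-e part of the K-subalgebra generated by these linear forms:
   K-span of the products of e of the generators *)
Definition in_retract_deg (m : nat) (A : 'M[K]_(m, n)) (e : int)
  (p : {mpoly K[n]}) : Prop :=
  p = 0 \/ exists2 j : nat, e = j%:Z &
    exists c : {ffun j.-tuple 'I_m -> K},
      p = \sum_(t : j.-tuple 'I_m) c t *: \prod_(l < j) lin_form A (tnth t l).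

(* Krull dimension of the retract = dimension of the span of its
   generating linear forms *)
Definition retract_dim (m : nat) (A : 'M[K]_(m, n)) : nat := \rank A.

(* A Hilbert decomposition (S_i, s_i)_{i < N} of M(n,k) all of whose
   retracts have dimension >= dep: a graded K-linear isomorphism
   M(n,k) ~= (+)_i S_i(-s_i), given degreewise. *)
Definition Hdec_depth_ge (k dep : nat) : Prop :=
  exists (N : nat) (r : 'I_N -> nat) (A : forall i : 'I_N, 'M[K]_(r i, n))
         (s : 'I_N -> int),
    (forall i, (dep <= retract_dim (A i))%N) /\
    exists phi : int -> wedge -> {ffun 'I_N -> {mpoly K[n]}},
      forall d : int,
        (forall (a : K) x y, inM_deg k d x -> inM_deg k d y ->
            phi d (a *: x + y) = a *: phi d x + phi d y) /\
        (forall x, inM_deg k d x -> forall i,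
            in_retract_deg (A i) (d - s i) (phi d x i)) /\
        (forall x y, inM_deg k d x -> inM_deg k d y ->
            phi d x = phi d y -> x = y) /\
        (forall z : {ffun 'I_N -> {mpoly K[n]}},
            (forall i, in_retract_deg (A i) (d - s i) (z i)) ->
            exists2 x, inM_deg k d x & phi d x = z).

End Koszul.

Section Asym.
Local Open Scope R_scope.
Definition Hdepth_asym (K : fieldType) (k : nat -> nat) (g : R) : Prop :=
  forall eps : R, 0 < eps -> exists N : nat, forall n : nat, (N <= n)%N ->
    (exists dep : nat, Hdec_depth_ge K n (k n) dep /\
        (((1 - g - eps) * INR n) <= INR dep)) /\
    (forall dep : nat, Hdec_depth_ge K n (k n) dep ->
        (INR dep <= (1 - g + eps) * INR n)).

End Asym.

(* Main.v *)
(** Exactness of the Koszul complex in each multidegree shows that an element of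
    [M(n, k)] is determined by its coordinates [x^c e_J] with
    [min (supp c) < min J], and that these can be prescribed freely.  Counting
    them gives [H_k + H_(k+1) = C(n, k) T^k / (1 - T)^n] for the Hilbert series
    [H_k] of [M(n, k)], with [H_0 = 1].

    Hence the coefficient of [T^e] in [(1 - T)^(n - g) H_k] is, on the one hand, the
    alternating sum over [j < k] of [t_j = C(n, j) C(e - j + g - 1, g - 1)] corrected
    by [(-1)^(k + e) C(n - g, e)] and, on the other hand, the alternating sum over
    [j >= k] of the [t_j].  The [t_j] are log-concave in [j], so one of the two sums is
    alternating with monotone terms: a coefficient can be negative only if
    [t_(k-1)] is not much larger than [C(n - g, e)], and it is negative for odd
    [k + e] if [t_(k-1)] is exponentially smaller.  When all coefficients are
    nonnegative, cutting the series at degree [n] and expanding the tail by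
    backward differences yields a Hilbert decomposition of depth [n - g].

    With [k = b n], [g = c n], [e = (a + b) n] the exponential rate of
    [t_(k-1) / C(n - g, e)] is the logarithm of the left hand side of the equation
    for [gamma].  It increases in [c], and over [a] it is smallest either at [a = 0],
    where it is nonnegative, or at [a = alpha]. *)

Require Import Defs.
From Stdlib Require Import Reals Lra ClassicalEpsilon.
From Coquelicot Require Import Coquelicot.

(** * The exponential rate and its zero *)

Section RealAnalysis.
Local Open Scope R_scope.

(** The logarithm of [xpx] on nonnegative arguments, continued by 0 to negative ones. The result is
    continuous on the whole line, so continuity and compactness arguments need no side
    conditions. *)
Definition xlnx (x : R) : R := if Rle_dec x 0 then 0 else x * ln x.

Lemma xlnx_pos x : 0 < x -> xlnx x = x * ln x.
Proof. intros Hx; unfold xlnx; destruct (Rle_dec x 0); lra. Qed.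

Lemma xlnx_0 : xlnx 0 = 0.
Proof. unfold xlnx; destruct (Rle_dec 0 0); lra. Qed.

Lemma xlnx_1 : xlnx 1 = 0.
Proof. rewrite xlnx_pos, ln_1; lra. Qed.

Lemma xpx_exp x : 0 <= x -> xpx x = exp (xlnx x).
Proof.
  intros Hx; unfold xpx; destruct (Req_EM_T x 0) as [->|Hn].
  - now rewrite xlnx_0, exp_0.
  - rewrite xlnx_pos by lra; reflexivity.
Qed.

Lemma ln_le_sub1 x : 0 < x -> ln x <= x - 1.
Proof.
  intros Hx.
  destruct (Req_dec (ln x) 0) as [E|E].
  - assert (x = 1) by (rewrite <- (exp_ln x Hx), E; apply exp_0). lra.
  - pose proof (exp_ineq1 (ln x) E) as H; rewrite exp_ln in H by easy; lra.
Qed.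

(** Comes from [ln x = 2 * ln (sqrt x)] and [- ln y <= / y] at [y = sqrt x]; it gives the continuity
    of [xlnx] at 0. *)
Lemma xlnx_small x : 0 < x <= 1 -> - 2 * sqrt x <= xlnx x <= 0.
Proof.
  intros [H0 H1].
  assert (Hs : 0 < sqrt x) by now apply sqrt_lt_R0.
  assert (Hsq : sqrt x * sqrt x = x) by (apply sqrt_sqrt; lra).
  rewrite xlnx_pos by easy.
  assert (Hl : ln x = 2 * ln (sqrt x)).
  { rewrite <- Hsq at 1; rewrite ln_mult by easy; lra. }
  assert (Hi : - ln (sqrt x) <= / sqrt x).
  { rewrite <- ln_Rinv by easy.
    pose proof (ln_le_sub1 (/ sqrt x) (Rinv_0_lt_compat _ Hs)); lra. }
  assert (H2 : x * / sqrt x = sqrt x).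
  { rewrite <- Hsq at 1; field; lra. }
  split.
  - rewrite Hl.
    assert (x * - ln (sqrt x) <= x * / sqrt x) by (apply Rmult_le_compat_l; lra). lra.
  - pose proof (ln_le_sub1 x H0); nra.
Qed.

Lemma is_derive_xlnx x : 0 < x -> is_derive xlnx x (ln x + 1).
Proof.
  intros Hx.
  apply (is_derive_ext_loc (fun y => y * ln y)).
  - exists (mkposreal x Hx); intros y Hy.
    rewrite xlnx_pos; [easy|].
    apply Rabs_lt_between in Hy; unfold minus, plus, opp in Hy; simpl in Hy; lra.
  - auto_derive; [easy|field; lra].
Qed.

Lemma continuity_xlnx : continuity xlnx.
Proof.
  intros x.
  destruct (Rtotal_order x 0) as [Hx|[->|Hx]].
  - apply continuity_pt_filterlim.
    apply (continuous_ext_loc _ (fun _ => 0)).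
    + assert (Hx' : 0 < - x) by lra.
      exists (mkposreal _ Hx'); intros y Hy.
      apply Rabs_lt_between in Hy; unfold minus, plus, opp in Hy; simpl in Hy.
      unfold xlnx; destruct (Rle_dec y 0); lra.
    + apply continuous_const.
  - intros eps Heps.
    (* Chosen to give [2 * sqrt y < eps]; the bound 1 keeps [y] in the range of [xlnx_small]. *)
    exists (Rmin 1 (eps * eps / 4)); split.
    { apply Rmin_pos; nra. }
    intros y [_ Hy]; simpl in *; unfold Rdist in *.
    rewrite xlnx_0; rewrite Rminus_0_r in *.
    pose proof (Rmin_l 1 (eps * eps / 4)).
    pose proof (Rmin_r 1 (eps * eps / 4)).
    destruct (Rle_dec y 0) as [Hn|Hp].
    + replace (xlnx y) with 0 by (unfold xlnx; destruct (Rle_dec y 0); easy).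
      rewrite Rabs_R0; easy.
    + rewrite Rabs_pos_eq in Hy by lra.
      destruct (xlnx_small y) as [Ha Hb]; [lra|].
      rewrite Rabs_left1 by easy.
      assert (sqrt y < eps / 2); [|lra].
      rewrite <- (sqrt_Rsqr (eps / 2)) by lra.
      apply sqrt_lt_1; unfold Rsqr; nra.
  - apply derivable_continuous_pt.
    exists (ln x + 1); apply is_derive_Reals, is_derive_xlnx, Hx.
Qed.

Lemma ex_derive_xlnx x : 0 < x -> ex_derive xlnx x.
Proof. intros Hx; exists (ln x + 1); now apply is_derive_xlnx. Qed.

Lemma Derive_xlnx x : 0 < x -> Derive xlnx x = ln x + 1.
Proof. intros Hx; now apply is_derive_unique, is_derive_xlnx. Qed.

Lemma continuous_xlnx x : continuous xlnx x.
Proof. apply continuity_pt_filterlim, continuity_xlnx. Qed.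

Lemma continuous_xlnx_comp (u : R -> R) x :
  continuous u x -> continuous (fun t => xlnx (u t)) x.
Proof. intros Hu; apply (continuous_comp u xlnx); [easy|apply continuous_xlnx]. Qed.

(** Differentiability is asked for in the open interval only, since the derivatives of the rate may
    blow up on the boundary of its domain. *)
Lemma mvt_open (h dh : R -> R) x y : x < y ->
  (forall c, x <= c <= y -> continuous h c) ->
  (forall c, x < c < y -> is_derive h c (dh c)) ->
  exists c, x < c < y /\ h y - h x = dh c * (y - x).
Proof.
  intros Hxy Hc Hd.
  assert (pr1 : forall c, x < c < y -> derivable_pt h c).
  { intros c Hcc; exists (dh c); apply is_derive_Reals, Hd, Hcc. }
  assert (pr2 : forall c, x < c < y -> derivable_pt id c).
  { intros c _; apply derivable_pt_id. }
  destruct (MVT h id x y pr1 pr2 Hxy) as (c & Hcc & E).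
  - intros c Hcc; apply continuity_pt_filterlim, Hc, Hcc.
  - intros c _; apply derivable_continuous_pt, derivable_pt_id.
  - exists c; split; [easy|].
    assert (D1 : derive_pt h c (pr1 c Hcc) = dh c).
    { apply derive_pt_eq_0, is_derive_Reals, Hd, Hcc. }
    assert (D2 : derive_pt id c (pr2 c Hcc) = 1).
    { apply derive_pt_eq_0, derivable_pt_lim_id. }
    rewrite D1, D2 in E; unfold id in E; lra.
Qed.

(** The logarithm of the left hand side of the equation for [gamma] ([rate_exp]), and the
    exponential growth rate of [C(n, k) C(m + g, m) / C(n - g, m + k)] for [m], [k], [g]
    proportional to [n] ([rate_scale]). *)
Definition rate (a b g : R) : R :=
  xlnx (a + g) + xlnx (a + b) + xlnx (1 - a - b - g)
  - xlnx a - xlnx b - xlnx g - xlnx (1 - b) - xlnx (1 - g).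

Lemma continuous_Rplus (u v : R -> R) x :
  continuous u x -> continuous v x -> continuous (fun t => u t + v t) x.
Proof. exact (continuous_plus (V := R_NormedModule) u v x). Qed.

Lemma continuous_Rminus (u v : R -> R) x :
  continuous u x -> continuous v x -> continuous (fun t => u t - v t) x.
Proof. exact (continuous_minus (V := R_NormedModule) u v x). Qed.

Ltac cont_rate :=
  repeat first
    [ apply continuous_const | apply continuous_id | assumption
    | simple apply continuous_Rminus | simple apply continuous_Rplus
    | simple apply continuous_xlnx_comp ].

Lemma continuous_rate_a b g a : continuous (fun a => rate a b g) a.
Proof. unfold rate; cont_rate. Qed.

Lemma continuous_rate_g a b g : continuous (fun g => rate a b g) g.
Proof. unfold rate; cont_rate. Qed.

Lemma is_derive_rate_a a b g : 0 < a -> 0 < b -> 0 <= g -> a + b + g < 1 ->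
  is_derive (fun a => rate a b g) a
    (ln ((a + g) * (a + b)) - ln (a * (1 - a - b - g))).
Proof.
  intros Ha Hb Hg H1; unfold rate.
  auto_derive.
  - repeat split; apply ex_derive_xlnx; lra.
  - rewrite !Derive_xlnx by lra.
    rewrite !ln_mult by lra; unfold Rminus; ring.
Qed.

Lemma is_derive_rate_g a b g : 0 <= a -> 0 < b -> 0 < g -> a + b + g < 1 ->
  is_derive (fun g => rate a b g) g
    (ln ((a + g) * (1 - g)) - ln (g * (1 - a - b - g))).
Proof.
  intros Ha Hb Hg H1; unfold rate.
  auto_derive.
  - repeat split; apply ex_derive_xlnx; lra.
  - rewrite !Derive_xlnx by lra.
    rewrite !ln_mult by lra; unfold Rminus; ring.
Qed.

(** In the derivative at [c] the arguments of the two logarithms differ by [a + b * c], which is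
    positive. *)
Lemma rate_incr_g a b g1 g2 : 0 <= a -> 0 < b -> 0 <= g1 -> g1 < g2 ->
  a + b + g2 <= 1 -> rate a b g1 < rate a b g2.
Proof.
  intros Ha Hb Hg H12 H1.
  destruct (mvt_open (fun g => rate a b g) _ g1 g2 H12
    (fun c _ => continuous_rate_g a b c)
    (fun c Hc => is_derive_rate_g a b c Ha Hb ltac:(lra) ltac:(lra))) as (c & Hc & E).
  assert (0 < ln ((a + c) * (1 - c)) - ln (c * (1 - a - b - c))); [|nra].
  apply Rlt_0_minus, ln_increasing; nra.
Qed.

Lemma rate_00 b : rate 0 b 0 = 0.
Proof.
  unfold rate.
  replace (0 + 0) with 0 by ring; replace (0 + b) with b by ring.
  replace (1 - 0 - b - 0) with (1 - b) by ring; replace (1 - 0) with 1 by ring.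
  rewrite xlnx_0, xlnx_1; ring.
Qed.

Lemma rate_0_nonneg b g : 0 < b -> 0 <= g -> b + g <= 1 -> 0 <= rate 0 b g.
Proof.
  intros Hb [Hg| <-] H1; [|rewrite rate_00; lra].
  pose proof (rate_incr_g 0 b 0 g); rewrite rate_00 in *; lra.
Qed.

(* The sign of the derivative in [a] is that of this quadratic, whose larger
   root is [alpha_of]. *)
Definition rate_quad (a b g : R) : R := 2 * a * a - (1 - 2 * b - 2 * g) * a + b * g.

Lemma rate_mono_a b g x y : 0 < b -> 0 <= g -> 0 <= x -> x <= y -> y + b + g <= 1 ->
  (forall a, x < a < y -> 0 <= rate_quad a b g) -> rate x b g <= rate y b g.
Proof.
  intros Hb Hg Hx [Hxy| ->] H1 HQ; [|lra].
  destruct (mvt_open (fun a => rate a b g) _ x y Hxy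
    (fun c _ => continuous_rate_a b g c)
    (fun c Hc => is_derive_rate_a c b g ltac:(lra) Hb Hg ltac:(lra))) as (c & Hc & E).
  specialize (HQ c Hc); unfold rate_quad in HQ.
  assert (0 <= ln ((c + g) * (c + b)) - ln (c * (1 - c - b - g))); [|nra].
  apply Rge_le, Rge_minus, Rle_ge, ln_le; [|nra]. apply Rmult_lt_0_compat; lra.
Qed.

Lemma rate_anti_a b g x y : 0 < b -> 0 <= g -> 0 <= x -> x <= y -> y + b + g <= 1 ->
  (forall a, x < a < y -> rate_quad a b g <= 0) -> rate y b g <= rate x b g.
Proof.
  intros Hb Hg Hx [Hxy| ->] H1 HQ; [|lra].
  destruct (mvt_open (fun a => rate a b g) _ x y Hxy
    (fun c _ => continuous_rate_a b g c)
    (fun c Hc => is_derive_rate_a c b g ltac:(lra) Hb Hg ltac:(lra))) as (c & Hc & E).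
  specialize (HQ c Hc); unfold rate_quad in HQ.
  assert (0 <= ln (c * (1 - c - b - g)) - ln ((c + g) * (c + b))); [|nra].
  apply Rge_le, Rge_minus, Rle_ge, ln_le; [|nra]. apply Rmult_lt_0_compat; lra.
Qed.

Section Critical.
Variables b g : R.
Let disc := (1 - 2 * b - 2 * g) ^ 2 - 8 * b * g.
Let ap := alpha_of b g.
Hypotheses (Hb : 0 < b) (Hb2 : b <= / 2) (Hg : 0 <= g) (Hd : 0 <= disc) (Ha : 0 <= ap).

Lemma rate_quad_factor a :
  rate_quad a b g = 2 * (a - ap) * (a - (1 - 2 * b - 2 * g) / 2 + ap).
Proof.
  unfold rate_quad, ap, alpha_of.
  pose proof (sqrt_sqrt _ Hd) as Hs; fold disc; unfold disc in Hs at 3.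
  set (s := sqrt disc) in *. simpl in Hs. nra.
Qed.

(** The roots of [rate_quad] have the sum [(1 - 2 * b - 2 * g) / 2], so the smaller root is
    nonnegative. Moreover [ap + b + g <= / 2], so that the critical point lies in the domain of the
    rate. *)
Lemma alpha_le_half : ap <= (1 - 2 * b - 2 * g) / 2.
Proof.
  pose proof (sqrt_sqrt _ Hd) as Hs; pose proof (sqrt_pos disc) as Hp.
  unfold ap, alpha_of in Ha |- *; fold disc in Ha |- *.
  set (s := sqrt disc) in *.
  assert (E : s * s = (1 - 2 * b - 2 * g) * (1 - 2 * b - 2 * g) - 8 * (b * g)).
  { rewrite Hs; unfold disc; ring. }
  set (u := 1 - 2 * b - 2 * g) in *.
  assert (Hbg : 0 <= b * g) by nra.
  (* If [u] were negative, [0 <= ap] would give [- u <= s], hence [b * g = 0] and [g = 0]; but then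
     [u = 1 - 2 * b] is nonnegative. *)
  assert (Hu : 0 <= u).
  { destruct (Rle_dec 0 u) as [|Hn]; [easy|].
    assert (Hbg0 : b * g = 0) by nra.
    destruct (Rmult_integral _ _ Hbg0) as [Z|Z]; [lra|].
    unfold u in Hn; lra. }
  assert (s <= u) by nra. lra.
Qed.

(** The rate increases in [a] up to the smaller root [am] of [rate_quad], decreases up to the larger
    root [ap] and increases afterwards. *)
Lemma rate_min_a a : 0 <= a -> a + b + g <= 1 ->
  rate 0 b g <= rate a b g \/ rate ap b g <= rate a b g.
Proof.
  intros H0 H1.
  set (am := (1 - 2 * b - 2 * g) / 2 - ap).
  pose proof alpha_le_half as Hal.
  assert (Ham : am <= ap).
  { unfold am, ap, alpha_of; fold disc; pose proof (sqrt_pos disc); lra. }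
  assert (HQ : forall x, rate_quad x b g = 2 * (x - ap) * (x - am)).
  { intros x; rewrite rate_quad_factor; unfold am; ring. }
  assert (Ham0 : 0 <= am) by (unfold am; lra).
  destruct (Rle_dec a am) as [A1|A1].
  - left; apply rate_mono_a; try lra. intros x Hx; rewrite HQ; nra.
  - right. destruct (Rle_dec a ap) as [A2|A2].
    + apply rate_anti_a; try lra. intros x Hx; rewrite HQ; nra.
    + apply rate_mono_a; try lra. intros x Hx; rewrite HQ; nra.
Qed.

End Critical.

Lemma continuous_alpha_of b g : continuous (alpha_of b) g.
Proof.
  unfold alpha_of.
  apply (continuous_scal_r (V := R_NormedModule) (/ 4)
     (fun g => 1 - 2 * b - 2 * g + sqrt ((1 - 2 * b - 2 * g) ^ 2 - 8 * b * g))).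
  assert (H : forall c : R, continuous (fun g : R => c * g) g).
  { intros c; apply (continuous_scal_r (V := R_NormedModule) c (fun g => g)), continuous_id. }
  apply continuous_Rplus; [apply continuous_Rminus; [apply continuous_const|apply H]|].
  apply (continuous_comp (fun g => (1 - 2 * b - 2 * g) ^ 2 - 8 * b * g) sqrt);
    [|apply continuous_sqrt].
  apply continuous_Rminus; [|apply H].
  apply continuity_pt_filterlim; reg.
Qed.

Lemma continuous_rate_alpha b g : continuous (fun g => rate (alpha_of b g) b g) g.
Proof.
  pose proof (continuous_alpha_of b g).
  unfold rate; cont_rate.
Qed.

(** * Solutions of the equation for [gamma] *)

Lemma rate_exp a b g : 0 <= a -> 0 < b -> b <= / 2 -> 0 <= g -> a + b + g <= 1 ->
  xpx (a + g) * xpx (a + b) * xpx (1 - a - b - g) /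
   (xpx a * xpx b * xpx g * xpx (1 - b) * xpx (1 - g)) = exp (rate a b g).
Proof.
  intros; rewrite !xpx_exp by lra; unfold rate.
  unfold Rminus; rewrite !exp_plus, !exp_Ropp.
  field; repeat split; apply Rgt_not_eq, exp_pos.
Qed.

Lemma is_solution_rate b g : 0 < b -> b <= / 2 ->
  is_solution b g <->
  0 <= g /\ 0 <= (1 - 2 * b - 2 * g) ^ 2 - 8 * b * g /\ 0 <= alpha_of b g /\
  rate (alpha_of b g) b g = 0.
Proof.
  intros Hb Hb2; unfold is_solution; split.
  - intros (Hg & Hd & Ha & H1 & H2 & E); repeat split; try easy.
    rewrite rate_exp in E by lra.
    apply exp_inv; now rewrite E, exp_0.
  - intros (Hg & Hd & Ha & E).
    pose proof (alpha_le_half b g Hb Hb2 Hg Hd Ha).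
    repeat split; try easy; try lra.
    rewrite rate_exp by lra. now rewrite E, exp_0.
Qed.

(** Of the two candidates for the minimum, [a = 0] gives a nonnegative value and the critical point
    gives 0. *)
Lemma solution_rate_nonneg b g a : 0 < b -> b <= / 2 -> is_solution b g ->
  0 <= a -> a + b + g <= 1 -> 0 <= rate a b g.
Proof.
  intros Hb Hb2 Hs Ha H1.
  apply is_solution_rate in Hs; try easy.
  destruct Hs as (Hg & Hd & Hal & E).
  destruct (rate_min_a b g Hb Hb2 Hg Hd Hal a Ha H1) as [H|H]; [|lra].
  apply Rle_trans with (2 := H), rate_0_nonneg; lra.
Qed.

Lemma solution_above b g g' a : 0 < b -> b <= / 2 -> is_solution b g -> g < g' ->
  0 <= a -> a + b + g' <= 1 -> 0 < rate a b g'.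
Proof.
  intros Hb Hb2 Hs Hg Ha H1.
  apply Rle_lt_trans with (rate a b g).
  - apply solution_rate_nonneg; try easy; lra.
  - apply rate_incr_g; try easy; destruct Hs; lra.
Qed.

Lemma solution_le_half b g : 0 < b -> b <= / 2 -> is_solution b g -> b + g <= / 2.
Proof.
  intros Hb Hb2 Hs; apply is_solution_rate in Hs; try easy.
  destruct Hs as (Hg & Hd & Hal & _).
  pose proof (alpha_le_half b g Hb Hb2 Hg Hd Hal); lra.
Qed.

(** The critical point [alpha_of b g] belonging to the solution is kept: the rate is 0 there and
    drops when [g] is lowered to [g']. The inequality between [b * (a + g')] and [(1 - b) * a]
    follows from the quadratic equation for [a]; it will put the index [k] in the range where the
    terms [t_j] increase. *)
Lemma solution_below b g g' : 0 < b -> b <= / 2 -> is_solution b g ->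
  0 <= g' -> g' < g ->
  exists a, 0 < a /\ a + b + g' < 1 /\ b * (a + g') < (1 - b) * a /\ rate a b g' < 0.
Proof.
  intros Hb Hb2 Hs Hg' Hg; exists (alpha_of b g).
  apply is_solution_rate in Hs; try easy.
  destruct Hs as (Hg0 & Hd & Hal & E).
  pose proof (alpha_le_half b g Hb Hb2 Hg0 Hd Hal) as Hh.
  pose proof (rate_quad_factor b g Hd (alpha_of b g)) as HQ.
  replace (alpha_of b g - alpha_of b g) with 0 in HQ by ring.
  unfold rate_quad in HQ.
  set (a := alpha_of b g) in *.
  assert (Ha : 0 < a).
  { destruct Hal as [|Z]; [easy|]. rewrite <- Z in HQ.
    assert (0 < b * g) by (apply Rmult_lt_0_compat; lra). lra. }
  repeat split; try easy; try lra.
  - assert (b * g' < b * g) by (apply Rmult_lt_compat_l; lra). nra.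
  - rewrite <- E; apply rate_incr_g; lra.
Qed.

(** Intermediate value theorem for the rate at the critical point. For [g = 0] the rate decreases
    from 0 up to that point; at the zero of the discriminant it is monotone in [a], hence
    nonnegative. By [solution_above] a solution below the one found would make the rate positive at
    the latter. *)
Lemma smallest_solution_ex b : 0 < b -> b <= / 2 -> exists g, smallest_solution b g.
Proof.
  intros Hb Hb2.
  set (s := sqrt (b * (1 - b))).
  assert (Hs : s * s = b * (1 - b)) by (apply sqrt_sqrt; nra).
  assert (Hs0 : 0 <= s) by apply sqrt_pos.
  (* the zero of the discriminant, where both critical points of the rate coincide *)
  set (g0 := / 2 - s).
  assert (Hg0 : 0 <= g0) by (unfold g0; nra).
  assert (Hdisc : forall g, (1 - 2 * b - 2 * g) ^ 2 - 8 * b * g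
                    = 4 * (g0 - g) * (1 - g0 - g)).
  { intros g; unfold g0. replace (4 * (/ 2 - s - g) * (1 - (/ 2 - s) - g))
      with (1 - 4 * g + 4 * g * g - 4 * (s * s)) by field.
    rewrite Hs; ring. }
  assert (Hu : 0 <= 1 - 2 * b - 2 * g0) by (unfold g0; nra).
  assert (Hdom : forall g, 0 <= g <= g0 ->
     0 <= (1 - 2 * b - 2 * g) ^ 2 - 8 * b * g /\ 0 <= alpha_of b g).
  { intros g Hg; split.
    - rewrite Hdisc; apply Rmult_le_pos; unfold g0 in *; lra.
    - unfold alpha_of; pose proof (sqrt_pos ((1 - 2 * b - 2 * g) ^ 2 - 8 * b * g)); lra. }
  assert (HF0 : rate (alpha_of b 0) b 0 <= 0).
  { destruct (Hdom 0) as [Hd Ha]; [lra|].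
    pose proof (alpha_le_half b 0 Hb Hb2 (Rle_refl 0) Hd Ha) as Hh.
    rewrite <- (rate_00 b) at 3.
    apply rate_anti_a; try lra.
    intros x Hx. unfold rate_quad; nra. }
  assert (HF1 : 0 <= rate (alpha_of b g0) b g0).
  { destruct (Hdom g0) as [Hd Ha]; [lra|].
    pose proof (alpha_le_half b g0 Hb Hb2 Hg0 Hd Ha) as Hh.
    apply Rle_trans with (rate 0 b g0); [apply rate_0_nonneg; lra|].
    apply rate_mono_a; try lra.
    intros x _; rewrite rate_quad_factor by easy.
    replace (x - (1 - 2 * b - 2 * g0) / 2 + alpha_of b g0) with (x - alpha_of b g0).
    - pose proof (Rle_0_sqr (x - alpha_of b g0)) as Hq; unfold Rsqr in Hq; lra.
    - assert (Z : sqrt ((1 - 2 * b - 2 * g0) ^ 2 - 8 * b * g0) = 0).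
      { rewrite Hdisc; replace (4 * (g0 - g0) * (1 - g0 - g0)) with 0 by ring; apply sqrt_0. }
      unfold alpha_of; rewrite Z; field. }
  destruct (IVT_gen (fun g => rate (alpha_of b g) b g) 0 g0 0) as (g & Hg & Eg).
  - intros g; apply continuity_pt_filterlim, continuous_rate_alpha.
  - rewrite Rmin_left, Rmax_right by lra; lra.
  - rewrite Rmin_left, Rmax_right in Hg by lra.
    assert (Hsol : is_solution b g).
    { apply is_solution_rate; try easy.
      destruct (Hdom g Hg); repeat split; try easy; lra. }
    exists g; split; [easy|].
    intros g' Hs'; apply Rnot_lt_le; intros Hlt.
    destruct (Hdom g Hg) as [Hd Ha].
    pose proof (alpha_le_half b g Hb Hb2 (proj1 Hg) Hd Ha).
    pose proof (solution_above b g' g (alpha_of b g) Hb Hb2 Hs' Hlt Ha ltac:(lra)). lra.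
Qed.

(** * Scaling, uniform continuity and growth estimates *)

Lemma xlnx_scale N x : 0 < N -> 0 <= x -> xlnx x = N * xlnx (x / N) + x * ln N.
Proof.
  intros HN [Hx| <-].
  - assert (0 < x / N) by now apply Rdiv_lt_0_compat.
    rewrite !xlnx_pos by easy.
    unfold Rdiv at 2; rewrite ln_mult, ln_Rinv by (try apply Rinv_0_lt_compat; easy).
    field; lra.
  - unfold Rdiv; rewrite Rmult_0_l, xlnx_0; ring.
Qed.

(** The left hand side is the entropy exponent of [C(N, k) C(m + g, m) / C(N - g, m + k)]. The
    multiples of [ln N] cancel within each of the three groups. *)
Lemma rate_scale N m k g : 0 < N -> 0 <= m -> 0 <= k -> 0 <= g -> m + k + g <= N ->
  (xlnx N - xlnx k - xlnx (N - k)) + (xlnx (m + g) - xlnx m - xlnx g)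
  - (xlnx (N - g) - xlnx (m + k) - xlnx (N - g - (m + k)))
  = N * rate (m / N) (k / N) (g / N).
Proof.
  intros HN Hm Hk Hg Hs.
  rewrite (xlnx_scale N N), (xlnx_scale N k), (xlnx_scale N (N - k)), (xlnx_scale N (m + g)),
    (xlnx_scale N m), (xlnx_scale N g), (xlnx_scale N (N - g)), (xlnx_scale N (m + k)),
    (xlnx_scale N (N - g - (m + k))) by lra.
  unfold rate.
  replace (N / N) with 1 by (field; lra).
  replace (m / N + g / N) with ((m + g) / N) by (field; lra).
  replace (m / N + k / N) with ((m + k) / N) by (field; lra).
  replace (1 - m / N - k / N - g / N) with ((N - g - (m + k)) / N) by (field; lra).
  replace (1 - k / N) with ((N - k) / N) by (field; lra).
  replace (1 - g / N) with ((N - g) / N) by (field; lra).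
  rewrite xlnx_1; ring.
Qed.

Lemma rate_unif eta : 0 < eta -> exists delta, 0 < delta /\
  forall a b g a' b' g', 0 <= a -> 0 <= b -> 0 <= g -> a + b + g <= 1 ->
    0 <= a' -> 0 <= b' -> 0 <= g' -> a' + b' + g' <= 1 ->
    Rabs (a - a') <= delta -> Rabs (b - b') <= delta -> Rabs (g - g') <= delta ->
    Rabs (rate a b g - rate a' b' g') < eta.
Proof.
  intros He.
  (* The rate consists of eight values of [xlnx], whose arguments move by at most three times the
     permitted shift: hence [eta / 8] here and [d / 4] below. *)
  assert (He8 : 0 < eta / 8) by lra.
  destruct (Heine xlnx (fun c => 0 <= c <= 1) (compact_P3 0 1)
     (fun x _ => continuity_xlnx x) (mkposreal _ He8)) as [[d Hd] H].
  simpl in H.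
  exists (d / 4); split; [lra|].
  intros a b g a' b' g' Ha Hb Hg Hs Ha' Hb' Hg' Hs' H1 H2 H3.
  apply Rabs_le_between in H1, H2, H3.
  assert (HX : forall x y, 0 <= x <= 1 -> 0 <= y <= 1 -> - d < x - y < d ->
                 - (eta / 8) < xlnx x - xlnx y < eta / 8).
  { intros x y Hx Hy Hxy; apply Rabs_lt_between, H; try easy; now apply Rabs_lt_between. }
  pose proof (HX (a + g) (a' + g') ltac:(lra) ltac:(lra) ltac:(lra)).
  pose proof (HX (a + b) (a' + b') ltac:(lra) ltac:(lra) ltac:(lra)).
  pose proof (HX (1 - a - b - g) (1 - a' - b' - g') ltac:(lra) ltac:(lra) ltac:(lra)).
  pose proof (HX a a' ltac:(lra) ltac:(lra) ltac:(lra)).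
  pose proof (HX b b' ltac:(lra) ltac:(lra) ltac:(lra)).
  pose proof (HX g g' ltac:(lra) ltac:(lra) ltac:(lra)).
  pose proof (HX (1 - b) (1 - b') ltac:(lra) ltac:(lra) ltac:(lra)).
  pose proof (HX (1 - g) (1 - g') ltac:(lra) ltac:(lra) ltac:(lra)).
  unfold rate; apply Rabs_lt_between; lra.
Qed.

(** The cube absorbs the polynomial factors of the entropy bounds and one more factor [n]. *)
Lemma cube_lt_exp c : 0 < c -> exists N0, 1 <= N0 /\
  forall N, N0 <= N -> (N + 1) ^ 3 < exp (c * N).
Proof.
  intros Hc.
  assert (Hc4 : 0 < c ^ 4) by now apply pow_lt.
  (* Since [(N + 1) ^ 3 <= 8 * N ^ 3] and [exp (c * N) > (c * N / 4) ^ 4], it suffices that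
     [N * c ^ 4] exceeds [8 * 256]. *)
  exists (1 + 2048 / c ^ 4); split.
  { assert (0 < 2048 / c ^ 4) by (apply Rdiv_lt_0_compat; lra). lra. }
  intros N HN.
  assert (H0 : 0 < 2048 / c ^ 4) by (apply Rdiv_lt_0_compat; lra).
  assert (HN1 : 1 < N) by lra.
  assert (HN4 : 2048 < N * c ^ 4).
  { apply (Rmult_lt_reg_r (/ c ^ 4)); [now apply Rinv_0_lt_compat|].
    replace (N * c ^ 4 * / c ^ 4) with N by (field; lra).
    unfold Rdiv in HN; lra. }
  assert (Hx : c * N / 4 < exp (c * N / 4)).
  { assert (0 < c * N) by (apply Rmult_lt_0_compat; lra).
    pose proof (exp_ineq1 (c * N / 4)); lra. }
  replace (exp (c * N)) with (exp (c * N / 4) ^ 4).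
  2: { replace (c * N) with (c * N / 4 + c * N / 4 + (c * N / 4 + c * N / 4)) at 2 by field.
       rewrite !exp_plus; ring. }
  apply Rlt_le_trans with ((c * N / 4) ^ 4).
  2: { apply pow_incr; split; [|lra].
       assert (0 < c * N) by (apply Rmult_lt_0_compat; lra); lra. }
  apply Rle_lt_trans with (8 * N ^ 3).
  { replace (8 * N ^ 3) with ((2 * N) ^ 3) by ring. apply pow_incr; lra. }
  replace ((c * N / 4) ^ 4) with (N * c ^ 4 * N ^ 3 / 256) by field.
  assert (0 < N ^ 3) by (apply pow_lt; lra). nra.
Qed.

Lemma nat_floor_ex x : 0 <= x -> exists m : nat, INR m <= x < INR m + 1.
Proof.
  intros Hx; destruct (nfloor_ex x Hx) as [m Hm]; now exists m.
Qed.

Lemma rate_min_pos b g' : 0 < b -> b + g' <= 1 ->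
  (forall a, 0 <= a -> a + b + g' <= 1 -> 0 < rate a b g') ->
  exists c, 0 < c /\ forall a, 0 <= a -> a + b + g' <= 1 -> c <= rate a b g'.
Proof.
  intros Hb H1 Hpos.
  destruct (continuity_ab_min (fun a => rate a b g') 0 (1 - b - g')) as (a0 & Hmin & H0).
  - lra.
  - intros a _; apply continuity_pt_filterlim, continuous_rate_a.
  - exists (rate a0 b g'); split; [apply Hpos; lra|].
    intros a Ha Ha1; apply Hmin; lra.
Qed.

Lemma exp_sub_mul x y z : exp (x - y - z) * (exp y * exp z) = exp x.
Proof. rewrite <- !exp_plus; f_equal; ring. Qed.

(** The limiting inequality holds with slack [theta], and the perturbations cost at most
    [(1 + b + 2 * a + g) * delta + delta ^ 2], which is below [10 * delta]. *)
Lemma ratio_cond b a g theta delta N k1 k0 m g1 :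
  0 < b <= / 2 -> 0 < a <= 1 -> 0 <= g <= / 2 -> 0 < N -> 0 < delta ->
  theta = (1 - b) * a - b * (a + g) -> 10 * delta <= theta ->
  k1 <= (b + delta) * N -> k0 <= (b + delta) * N ->
  (a - delta) * N <= m <= (a + delta) * N -> 0 <= g1 <= (g + delta) * N ->
  k1 * (m + g1) < (N - k0) * m.
Proof.
  intros Hb Ha Hg HN Hd Ht Htd Hk1 Hk0 Hm Hg1.
  assert (Hta : theta <= a) by nra.
  assert (H1 : k1 * (m + g1) <= (b + delta) * N * ((a + g + 2 * delta) * N)).
  { apply Rle_trans with ((b + delta) * N * (m + g1)).
    - apply Rmult_le_compat_r; [nra|easy].
    - apply Rmult_le_compat_l; nra. }
  assert (H2 : (1 - b - delta) * N * ((a - delta) * N) <= (N - k0) * m).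
  { apply Rmult_le_compat; nra. }
  apply Rle_lt_trans with (1 := H1); apply Rlt_le_trans with (2 := H2).
  replace ((b + delta) * N * ((a + g + 2 * delta) * N))
    with ((b + delta) * (a + g + 2 * delta) * (N * N)) by ring.
  replace ((1 - b - delta) * N * ((a - delta) * N))
    with ((1 - b - delta) * (a - delta) * (N * N)) by ring.
  apply Rmult_lt_compat_r; [nra|].
  nra.
Qed.

Lemma div_close x y N d : 0 < N -> Rabs (x - y * N) <= d * N -> Rabs (x / N - y) <= d.
Proof.
  intros HN H.
  replace (x / N - y) with ((x - y * N) * / N) by (field; lra).
  rewrite Rabs_mult, (Rabs_pos_eq (/ N)) by (left; now apply Rinv_0_lt_compat).
  apply (Rmult_le_reg_r N); [easy|].
  rewrite Rmult_assoc, Rinv_l by lra; lra.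
Qed.

Lemma div_nonneg_le x N : 0 < N -> 0 <= x -> 0 <= x / N.
Proof.
  intros HN Hx; apply Rmult_le_pos; [easy|]; left; now apply Rinv_0_lt_compat.
Qed.

Lemma div_sum_le1 x y z N : 0 < N -> x + y + z <= N -> x / N + y / N + z / N <= 1.
Proof.
  intros HN H; replace (x / N + y / N + z / N) with ((x + y + z) / N) by (field; lra).
  apply (Rmult_le_reg_r N); [easy|].
  unfold Rdiv; rewrite Rmult_assoc, Rinv_l by lra; lra.
Qed.

Lemma exp_neg_absurd N r eta : 1 <= N -> r <= - eta -> (N + 1) ^ 3 < exp (eta * N) ->
  N * ((N + 1) * exp (N * r)) < 1.
Proof.
  intros HN Hr H.
  assert (E : exp (N * r) * exp (eta * N) <= 1).
  { rewrite <- exp_plus, <- exp_0.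
    destruct (Req_dec (N * r + eta * N) 0) as [->|Hne]; [lra|].
    left; apply exp_increasing; nra. }
  pose proof (exp_pos (N * r)) as P.
  assert (Q : exp (N * r) * (N + 1) ^ 3 < 1).
  { apply Rlt_le_trans with (2 := E); now apply Rmult_lt_compat_l. }
  apply Rle_lt_trans with (2 := Q).
  replace (N * ((N + 1) * exp (N * r))) with (exp (N * r) * (N * (N + 1))) by ring.
  apply Rmult_le_compat_l; [lra|]. simpl; nra.
Qed.

Lemma exp_pos_dominates N r c X Y : 1 <= N -> c <= r -> (N + 1) ^ 3 < exp (c * N) ->
  0 <= X -> 0 <= Y -> exp (N * r) * X <= (N + 1) ^ 2 * Y -> N * X <= Y.
Proof.
  intros HN Hr H HX HY HXY.
  assert (E : (N + 1) ^ 3 <= exp (N * r)).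
  { apply Rle_trans with (exp (c * N)); [lra|].
    destruct (Req_dec (c * N) (N * r)) as [->|Hne]; [lra|].
    left; apply exp_increasing; nra. }
  assert (H2 : (N + 1) ^ 3 * X <= (N + 1) ^ 2 * Y).
  { apply Rle_trans with (2 := HXY); now apply Rmult_le_compat_r. }
  assert (H3 : (N + 1) * X <= Y).
  { apply (Rmult_le_reg_l ((N + 1) ^ 2)); [apply pow_lt; lra|].
    replace ((N + 1) ^ 2 * ((N + 1) * X)) with ((N + 1) ^ 3 * X) by ring; easy. }
  lra.
Qed.

Lemma rate_lower b g c delta x y z : 0 < b -> 0 <= g -> b + g < 1 ->
  (forall a, 0 <= a -> a + b + g <= 1 -> c <= rate a b g) -> 0 < c ->
  (forall a b' g' a' b'' g'', 0 <= a -> 0 <= b' -> 0 <= g' -> a + b' + g' <= 1 ->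
    0 <= a' -> 0 <= b'' -> 0 <= g'' -> a' + b'' + g'' <= 1 ->
    Rabs (a - a') <= delta -> Rabs (b' - b'') <= delta -> Rabs (g' - g'') <= delta ->
    Rabs (rate a b' g' - rate a' b'' g'') < c / 2) ->
  0 <= x -> 0 <= y -> 0 <= z -> x + y + z <= 1 ->
  Rabs (y - b) <= delta / 2 -> Rabs (z - g) <= delta / 2 -> c / 2 <= rate x y z.
Proof.
  intros Hb Hg Hbg Hc Hc0 Hu Hx Hy Hz Hs Hyb Hzg.
  apply Rabs_le_between in Hyb, Hzg.
  (* [x] itself may lie slightly outside the range in which the rate is bounded below *)
  set (a := Rmin x (1 - b - g)).
  assert (Ha : 0 <= a) by (apply Rmin_glb; lra).
  assert (Ha1 : a <= 1 - b - g) by apply Rmin_r.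
  assert (Hax : Rabs (x - a) <= delta).
  { unfold a, Rmin; destruct (Rle_dec x (1 - b - g)); apply Rabs_le_between; lra. }
  assert (H1 : Rabs (y - b) <= delta) by (apply Rabs_le_between; lra).
  assert (H2 : Rabs (z - g) <= delta) by (apply Rabs_le_between; lra).
  pose proof (Hu x y z a b g Hx Hy Hz Hs Ha ltac:(lra) Hg ltac:(lra) Hax H1 H2) as H.
  apply Rabs_lt_between in H.
  pose proof (Hc a Ha ltac:(lra)); lra.
Qed.

End RealAnalysis.

From HB Require Import structures.
From mathcomp Require Import all_boot all_order all_algebra zify ring mpoly.
Set Implicit Arguments. Unset Strict Implicit. Unset Printing Implicit Defensive.
Import Order.TTheory GRing.Theory Num.Theory.

(** * Entropy bounds for binomial coefficients *)

Section BinomialEntropy.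
Variables b c : nat.
(** The terms of the binomial expansion of [(c + b) ^ (b + c)]. The largest one has [i = b]; it is
    at most the whole sum and at least its average. *)
Let T i := ('C(b + c, i) * (c ^ (b + c - i) * b ^ i))%N.

Lemma bin_term_ratio i : (i < b + c)%N -> (T i.+1 * (i.+1 * c) = T i * ((b + c - i) * b))%N.
Proof.
move=> ia; rewrite /T.
have -> : (b + c - i = (b + c - i.+1).+1)%N by lia.
rewrite !expnS; have := mul_bin_left (b + c) i.
have -> : (b + c - i = (b + c - i.+1).+1)%N by lia.
set d := (b + c - i.+1)%N; move=> E.
transitivity ((i.+1 * 'C(b + c, i.+1)) * (c ^ d * (b * b ^ i) * c))%N; first by ring.
by rewrite E; ring.
Qed.

(** The ratio [T (i + 1) / T i = (b + c - i) b / ((i + 1) c)] is at least 1 for [i < b] and at most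
    1 afterwards. The degenerate cases [b = 0] and [c = 0] are separate. *)
Lemma bin_term_max i : (T i <= T b)%N.
Proof.
have up j : (j < b)%N -> (T j <= T j.+1)%N.
  move=> jb; case: (posnP c) => c0.
    by rewrite /T {2}c0 exp0n ?mul0n ?muln0 //; lia.
  have p0 : (0 < j.+1 * c)%N by rewrite muln_gt0 c0.
  rewrite -(leq_pmul2r p0) bin_term_ratio; last by lia.
  rewrite leq_mul2l; apply/orP; right; rewrite mulnC; apply: leq_mul => //; lia.
have down j : (b <= j)%N -> (T j.+1 <= T j)%N.
  move=> bj; case: (posnP b) => b0; first by rewrite /T b0 exp0n // !muln0.
  case: (posnP c) => c0; first by rewrite /T bin_small // c0 addn0 ltnS.
  case: (ltnP j (b + c)) => ja; last by rewrite /T bin_small.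
  have p0 : (0 < j.+1 * c)%N by rewrite muln_gt0 c0.
  rewrite -(leq_pmul2r p0) bin_term_ratio //.
  rewrite leq_mul2l; apply/orP; right; rewrite mulnC; apply: leq_mul => //; lia.
case: (leqP i b) => ib.
  have [m] := ubnP (b - i); elim: m i ib => // m IH i ib im.
  move: ib; rewrite leq_eqVlt => /orP [/eqP -> //|ib].
  by apply: leq_trans (up i ib) _; apply: IH => //; lia.
elim: i ib => // i IH; rewrite ltnS leq_eqVlt => /orP [/eqP <-|ib]; first exact: down.
by apply: leq_trans (down i (ltnW ib)) (IH ib).
Qed.

Lemma bin_term_sum : ((b + c) ^ (b + c) = \sum_(i < (b + c).+1) T i)%N.
Proof. by rewrite -(expnDn c b (b + c)) (addnC c b). Qed.

Lemma bin_term_mid : T b = ('C(b + c, b) * (b ^ b * c ^ c))%N.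
Proof. by rewrite /T addKn (mulnC (c ^ c)%N). Qed.

Lemma bin_entropy_ub : ('C(b + c, b) * (b ^ b * c ^ c) <= (b + c) ^ (b + c))%N.
Proof.
by rewrite bin_term_sum -bin_term_mid (bigD1 (inord b)) //= inordK ?ltnS ?leq_addr.
Qed.

Lemma bin_entropy_lb : ((b + c) ^ (b + c) <= (b + c).+1 * ('C(b + c, b) * (b ^ b * c ^ c)))%N.
Proof.
rewrite bin_term_sum -bin_term_mid -[X in (_ <= X * _)%N]card_ord -sum_nat_const.
by apply: leq_sum => i _; exact: bin_term_max.
Qed.

End BinomialEntropy.

Local Open Scope ring_scope.

(** * Coefficients of the Hilbert series *)

(* The number of monomials of degree [m] in [r] variables (also for [r = 0]). *)
Definition hilb (r m : nat) : nat := 'C((m + r).-1, m).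

(** The coefficient of [T^e] in [T^s / (1 - T)^r]. *)
Definition hilb_shift (r s e : nat) : nat := if (s <= e)%N then hilb r (e - s) else 0%N.

(** On generating series this is division by [1 - T]. *)
Definition psum (u : nat -> int) (e : nat) : int := \sum_(i < e.+1) u i.

Lemma hilb0n m : hilb 0 m = (m == 0%N).
Proof. by case: m => // m; rewrite /hilb addn0 /= bin_small. Qed.

Lemma hilbn0 r : hilb r 0 = 1%N.
Proof. by rewrite /hilb bin0. Qed.

Lemma hilbS r m : hilb r.+1 m.+1 = (hilb r.+1 m + hilb r m.+1)%N.
Proof. by rewrite /hilb !addSn !addnS /= binS addnC. Qed.

Lemma psum0 u : psum u 0 = u 0%N.
Proof. by rewrite /psum big_ord_recr big_ord0 /= add0r. Qed.

Lemma psumS u e : psum u e.+1 = psum u e + u e.+1.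
Proof. by rewrite /psum big_ord_recr. Qed.

Lemma eq_psum u v : u =1 v -> psum u =1 psum v.
Proof. by move=> uv e; apply: eq_bigr => i _. Qed.

Lemma psum_inj u v : psum u =1 psum v -> u =1 v.
Proof.
move=> uv [|e]; first by rewrite -(psum0 u) -(psum0 v).
by apply: (addrI (psum u e)); rewrite -psumS uv psumS uv.
Qed.

Lemma psum_sum I (s : seq I) (F : I -> nat -> int) e :
  psum (fun e => \sum_(i <- s) F i e) e = \sum_(i <- s) psum (F i) e.
Proof. by rewrite /psum exchange_big. Qed.

Lemma psumD u v e : psum (fun e => u e + v e) e = psum u e + psum v e.
Proof. by rewrite /psum big_split. Qed.

Lemma psumZ c u e : psum (fun e => c * u e) e = c * psum u e.
Proof. by rewrite /psum -mulr_sumr. Qed.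

Lemma hilb_shiftS r s e :
  (hilb_shift r.+1 s e)%:Z = psum (fun e => (hilb_shift r s e)%:Z) e.
Proof.
elim: e => [|e IH]; first by rewrite psum0 /hilb_shift leqn0; case: eqP => // ->; rewrite !hilbn0.
rewrite psumS -IH /hilb_shift leq_eqVlt ltnS.
case: eqP => [->|_] /=; first by rewrite subnn !hilbn0 ltnn.
by case: leqP => // se; rewrite subSn // hilbS PoszD.
Qed.

(** * The Hilbert series of [M(n, k)] times a power of [1 - T] *)

Section KoszulNumbers.
Variable n : nat.

(** The term [t_j]: the coefficient of [T^e] in [C(n, j) T^j / (1 - T)^g]. *)
Definition kterm (g j e : nat) : nat := ('C(n, j) * hilb_shift g j e)%N.

(* The coefficient of [T^e] in [(1 - T)^(n - g)] times the Hilbert series of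
   [M(n, k)], by the recursion that the exactness of the Koszul complex gives;
   the first value is that of [(1 - T)^(n - g)] itself. *)
Fixpoint kcoef (g k e : nat) : int :=
  if k is k'.+1 then (kterm g k' e)%:Z - kcoef g k' e
  else (-1) ^+ e * ('C(n - g, e))%:Z.

Lemma psum_sign_bin m e :
  (-1) ^+ e * ('C(m, e))%:Z = psum (fun e => (-1) ^+ e * ('C(m.+1, e))%:Z) e :> int.
Proof.
elim: e => [|e IH]; first by rewrite psum0 !bin0.
by rewrite psumS -IH binS PoszD exprS; ring.
Qed.

Lemma kcoef_psum g k e : (g < n)%N -> kcoef g.+1 k e = psum (kcoef g k) e.
Proof.
move=> gn; elim: k e => [|k IH] e /=.
  by rewrite psum_sign_bin; apply: eq_psum => i /=; rewrite subnSK.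
rewrite IH /kterm PoszM hilb_shiftS -psumZ -[in LHS]mulN1r -psumZ -psumD.
by apply: eq_psum => i /=; rewrite PoszM mulN1r.
Qed.

(** For [g = 0] the recursion removes the monomials of [(1 - T)^n] one by one: up to the sign
    [(-1)^k], what remains is the part of degree at least [k]. *)
Lemma kcoef0_small k e : (k <= e)%N -> kcoef 0 k e = (-1) ^+ (k + e) * ('C(n, e))%:Z.
Proof.
elim: k => [|k IH] ke /=; first by rewrite subn0.
rewrite IH ?(ltnW ke) // /kterm /hilb_shift (ltnW ke) hilb0n subn_eq0 leqNgt ke /= muln0.
by rewrite addSn exprS; ring.
Qed.

Lemma kcoef0_large k e : (e < k)%N -> kcoef 0 k e = 0.
Proof.
elim: k => // k IH; rewrite ltnS leq_eqVlt => /orP [/eqP <-|ek] /=.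
  rewrite kcoef0_small // /kterm /hilb_shift leqnn subnn hilbn0 muln1.
  by rewrite -signr_odd oddD addbb expr0 mul1r subrr.
by rewrite IH // /kterm /hilb_shift leqNgt ek /= muln0.
Qed.

Lemma kcoef0_gt k e : (n < e)%N -> kcoef 0 k e = 0.
Proof.
move=> ne; case: (leqP k e) => ke; last exact: kcoef0_large.
by rewrite kcoef0_small // bin_small ?mulr0.
Qed.

Lemma kcoef_last g e : (g <= n)%N -> kcoef g n.+1 e = 0.
Proof.
elim: g e => [|g IH] e gn.
  by case: (leqP e n) => en; [exact: kcoef0_large|exact: kcoef0_gt].
rewrite kcoef_psum // /psum big1 // => i _; apply: IH; exact: ltnW.
Qed.

Lemma kcoef_past_last g k e : (g <= n)%N -> (n < k)%N -> kcoef g k e = 0.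
Proof.
move=> gn; elim: k => // k IH; rewrite ltnS leq_eqVlt => /orP [/eqP <-|nk].
  exact: kcoef_last.
by rewrite /= IH // /kterm bin_small.
Qed.

(** The quotient [t_(j+1) / t_j], cross-multiplied so that it also holds for [e <= j]. *)
Lemma kterm_ratio g j e : (0 < g)%N ->
  (kterm g j.+1 e * (j.+1 * (e - j + g.-1)) = kterm g j e * ((n - j) * (e - j)))%N.
Proof.
case: g => // g _; rewrite /kterm /hilb_shift /=.
case: (leqP e j) => [ej|je].
  by move: ej; rewrite -subn_eq0 => /eqP ->; rewrite !muln0.
rewrite (ltnW je); set x := (e - j.+1)%N.
have -> : (e - j = x.+1)%N by rewrite /x; lia.
have H1 := mul_bin_left n j; have H2 := mul_bin_diag (x + g.+1) x.
rewrite /hilb; move: H1 H2; rewrite !addSn !addnS /= => H1 H2.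
transitivity ((j.+1 * 'C(n, j.+1)) * ((x + g).+1 * 'C(x + g, x)))%N; first by lia.
by rewrite H1 H2; lia.
Qed.

(* The ratios of consecutive terms are monotone: the terms are log-concave in [j]. *)
Lemma kterm_drop g j e : (0 < g)%N ->
  ((n - j) * (e - j) <= j.+1 * (e - j + g.-1))%N ->
  ((n - j.+1) * (e - j.+1) <= j.+2 * (e - j.+1 + g.-1))%N.
Proof.
case: g => // g _ /=.
case: (leqP e j.+1) => [ej|je]; first by move: ej; rewrite -subn_eq0 => /eqP ->; rewrite muln0.
case: (leqP n j.+1) => [ej|jn]; first by move: ej; rewrite -subn_eq0 => /eqP ->.
have [x ex] : exists x, (e = j.+2 + x)%N by exists (e - j.+2)%N; lia.
have [y ny] : exists y, (n = j.+2 + y)%N by exists (n - j.+2)%N; lia.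
have -> : (e - j = x.+2)%N by lia. have -> : (e - j.+1 = x.+1)%N by lia.
have -> : (n - j = y.+2)%N by lia. have -> : (n - j.+1 = y.+1)%N by lia.
nia.
Qed.

Lemma kterm_le_next g j e : (0 < g)%N ->
  ((n - j) * (e - j) <= j.+1 * (e - j + g.-1))%N -> (kterm g j.+1 e <= kterm g j e)%N.
Proof.
move=> g0 H; have E := kterm_ratio j e g0.
case: (leqP e j) => ej; first by rewrite /kterm /hilb_shift ltnNge ej /= muln0.
have B0 : (0 < j.+1 * (e - j + g.-1))%N by rewrite muln_gt0 addn_gt0 subn_gt0 ej.
by rewrite -(leq_pmul2r B0) E leq_mul2l H orbT.
Qed.

Lemma kterm_ge_next g j e : (0 < g)%N ->
  (j.+1 * (e - j + g.-1) < (n - j) * (e - j))%N -> (kterm g j e <= kterm g j.+1 e)%N.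
Proof.
move=> g0 H; have E := kterm_ratio j e g0.
have ej : (j < e)%N by rewrite -subn_gt0; case: (e - j)%N H => //; rewrite muln0.
have B0 : (0 < j.+1 * (e - j + g.-1))%N by rewrite muln_gt0 addn_gt0 subn_gt0 ej.
by rewrite -(leq_pmul2r B0) E leq_mul2l (ltnW H) orbT.
Qed.

(** Downward induction from [kcoef g n.+1 e = 0]: the coefficient is [t_k - t_(k+1) + ...], an
    alternating sum of decreasing terms. *)
Lemma kcoef_drop_ge0 g k e : (0 < g)%N -> (g <= n)%N ->
  ((n - k) * (e - k) <= k.+1 * (e - k + g.-1))%N -> 0 <= kcoef g k e <= (kterm g k e)%:Z.
Proof.
move=> g0 gn.
have [m] := ubnP (n.+1 - k); elim: m k => // m IH k km H.
case: (ltnP n k) => nk; first by rewrite kcoef_past_last //= lez_nat leq0n.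
have := IH k.+1 _ (kterm_drop g0 H); have := kterm_le_next g0 H.
have -> : (n.+1 - k.+1 < m)%N by lia.
by move=> le1 /(_ isT) /= ; lia.
Qed.

(** Without the contribution of [(1 - T)^(n - g)], the coefficient is the alternating sum
    [t_(k-1) - t_(k-2) + ...] over [j < k]. *)
Definition alt_tail (g k e : nat) : int := kcoef g k e - (-1) ^+ (k + e) * ('C(n - g, e))%:Z.

Lemma alt_tailS g k e : alt_tail g k.+1 e = (kterm g k e)%:Z - alt_tail g k e.
Proof. by rewrite /alt_tail /= addSn exprS; ring. Qed.

Lemma alt_tail0 g e : alt_tail g 0 e = 0.
Proof. by rewrite /alt_tail /= subrr. Qed.

Lemma alt_tail_ub g k e : `|alt_tail g k e| <= \sum_(j < k) (kterm g j e)%:Z.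
Proof.
elim: k => [|k IH]; first by rewrite alt_tail0 normr0 big_ord0.
rewrite alt_tailS big_ord_recr /=; apply: le_trans (ler_normB _ _) _.
rewrite [X in X <= _]addrC; apply: lerD => //.
Qed.

Lemma alt_tail_bounds g k e :
  (forall j, (j < k)%N -> (kterm g j e <= kterm g j.+1 e)%N) ->
  0 <= alt_tail g k.+1 e <= (kterm g k e)%:Z.
Proof.
elim: k => [|k IH] H; first by rewrite alt_tailS alt_tail0 subr0 lexx andbT.
have /andP [h0 h1] := IH (fun j jk => H j (ltnW jk)).
by have := H k (leqnn _); rewrite alt_tailS; lia.
Qed.

Lemma kterm_rise_all g k e j : (0 < g)%N ->
  (k.+1 * (e - k + g.-1) < (n - k) * (e - k))%N -> (j <= k)%N ->
  (j.+1 * (e - j + g.-1) < (n - j) * (e - j))%N.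
Proof.
move=> g0 H jk; rewrite ltnNge; apply/negP => Hj; move: H; rewrite ltnNge => /negP; apply.
elim: k jk => [|k IH]; first by rewrite leqn0 => /eqP <-.
rewrite leq_eqVlt => /orP [/eqP <- //|jk]; apply: kterm_drop => //; exact: IH.
Qed.

(** Beyond degree [n - g] the polynomial [(1 - T)^(n - g)] contributes nothing. The terms decrease
    from [k] on or increase up to [k], and accordingly one of the two alternating sums shows the
    sign. *)
Lemma kcoef_tail_ge0 g k e : (0 < g)%N -> (g <= n)%N -> (n - g < e)%N -> 0 <= kcoef g k e.
Proof.
move=> g0 gn ge.
case: (leqP ((n - k) * (e - k)) (k.+1 * (e - k + g.-1))) => H.
  by have /andP [] := kcoef_drop_ge0 g0 gn H.
have -> : kcoef g k e = alt_tail g k e by rewrite /alt_tail bin_small // mulr0 subr0.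
case: k H => [|k] H; first by rewrite alt_tail0.
have /andP [] // : 0 <= alt_tail g k.+1 e <= (kterm g k e)%:Z.
apply: alt_tail_bounds => j jk; apply: kterm_ge_next => //.
by apply: (kterm_rise_all g0 H); lia.
Qed.

(** If the terms decrease from [k + 2] on, [kcoef_drop_ge0] applies. Otherwise the coefficient is at
    least [t_(k+1) - t_k - C(n - g, e)], and [t_(k+1) - t_k] is at least [t_(k+1) / n]. *)
Lemma kcoef_ge0 g k e : (0 < g)%N -> (g <= n)%N -> (k.+1 <= n)%N ->
  (n * 'C(n - g, e) <= kterm g k.+1 e)%N -> 0 <= kcoef g k.+2 e.
Proof.
move=> g0 gn kn Ht.
case: (leqP ((n - k.+2) * (e - k.+2)) (k.+3 * (e - k.+2 + g.-1))) => H.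
  by have /andP [] := kcoef_drop_ge0 g0 gn H.
have H1 := kterm_rise_all g0 H (leqnSn _).
have H0 : (k.+1 * (e - k + g.-1) < (n - k) * (e - k))%N by apply: (kterm_rise_all g0 H); lia.
have ltke : (k.+1 < e)%N by rewrite -subn_gt0; case: (e - k.+1)%N H1 => //; rewrite muln0.
have ltkn : (k.+1 < n)%N by rewrite -subn_gt0; case: (n - k.+1)%N H1.
(* By strict log-concavity of the binomial coefficients: as [t_(k+2) / t_(k+1)] exceeds 1, the
   quotient [t_k / t_(k+1)] is at most [(k + 1) (n - k - 1) / ((k + 2) (n - k))], hence at most
   [(n - 1) / n]. *)
have gap : (n * kterm g k e <= n.-1 * kterm g k.+1 e)%N.
  have E := kterm_ratio k e g0.
  have [x ex] : exists x, (e = k.+2 + x)%N by exists (e - k.+2)%N; lia.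
  have [y ny] : exists y, (n = k.+2 + y)%N by exists (n - k.+2)%N; lia.
  move: E H1; rewrite {H0 H Ht}.
  have -> : (e - k = x.+2)%N by lia. have -> : (e - k.+1 = x.+1)%N by lia.
  have -> : (n - k = y.+2)%N by lia. have -> : (n - k.+1 = y.+1)%N by lia.
  have -> : (n.-1 = k.+1 + y)%N by lia.
  have -> : (n = k.+2 + y)%N by lia.
  case: g g0 gn => // g _ _ /=; set a := kterm _ k e; set b := kterm _ k.+1 e => E H1.
  have Hb : ((k.+2 + y) * (k.+1 * (x.+2 + g)) <= (k.+1 + y) * (y.+2 * x.+2))%N.
    have c0 : (0 < k.+2 * (x.+1 + g))%N by [].
    rewrite -(leq_pmul2r c0).
    apply: (@leq_trans ((k.+2 + y) * (k.+1 * (x.+2 + g)) * (y.+1 * x.+1))%N).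
      by rewrite leq_mul2l (ltnW H1) orbT.
    apply: (@leq_trans ((k.+2 + y) * k.+1 * y.+1 * (x.+2 * (x.+1 + g)))%N).
      have : ((x.+2 + g) * x.+1 <= x.+2 * (x.+1 + g))%N by lia.
      move/(leq_mul (leqnn ((k.+2 + y) * k.+1 * y.+1))); congr (_ <= _)%N; lia.
    have : ((k.+2 + y) * k.+1 * y.+1 <= (k.+1 + y) * y.+2 * k.+2)%N.
      apply: (@leq_trans (((k.+1 + y) * k.+2) * y.+1)%N); first by rewrite leq_mul2r; apply/orP; right; lia.
      by rewrite -!mulnA leq_mul2l mulnC leq_mul2r leqnSn !orbT.
    move/leq_mul/(_ (leqnn (x.+2 * (x.+1 + g)))); congr (_ <= _)%N; lia.
  have c0 : (0 < k.+1 * (x.+2 + g))%N by [].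
  have d0 : (0 < y.+2 * x.+2)%N by [].
  rewrite -(leq_pmul2r d0) -mulnA -E.
  rewrite [X in (X <= _)%N](_ : _ = (k.+2 + y) * (k.+1 * (x.+2 + g)) * b)%N; last by ring.
  by rewrite [X in (_ <= X)%N](_ : _ = (k.+1 + y) * (y.+2 * x.+2) * b)%N ?leq_mul2r ?Hb ?orbT //; ring.
have /andP [_ hub] : 0 <= alt_tail g k.+1 e <= (kterm g k e)%:Z.
  apply: alt_tail_bounds => j jk; apply: kterm_ge_next => //.
  by apply: (kterm_rise_all g0 H); lia.
have : `|(-1) ^+ (k.+2 + e) * ('C(n - g, e))%:Z| <= ('C(n - g, e))%:Z :> int.
  by rewrite normrM normrX normrN1 expr1n mul1r.
have -> : kcoef g k.+2 e = (kterm g k.+1 e)%:Z - alt_tail g k.+1 e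
     + (-1) ^+ (k.+2 + e) * ('C(n - g, e))%:Z by rewrite -alt_tailS /alt_tail addrNK.
set s := (-1) ^+ _ * _; set c := 'C(_, _) in Ht * => hs.
have : (c + kterm g k e <= kterm g k.+1 e)%N.
  have n0 : (0 < n)%N by lia.
  rewrite -(leq_pmul2l n0) mulnDr; move: gap Ht; case: (n) n0 => //= m _; lia.
by move: hs; lia.
Qed.

(** Division by [1 - T] is injective on series ([psum_inj]), so the common factor [1 / (1 - T)^dep]
    can be cancelled in a decomposition. *)
Lemma kcoef_strip dep k (l : seq (nat * nat)) e : (dep <= n)%N ->
  all (fun p => dep <= p.1)%N l ->
  (forall e, kcoef n k e = \sum_(p <- l) (hilb_shift p.1 p.2 e)%:Z) ->
  kcoef (n - dep) k e = \sum_(p <- l) (hilb_shift (p.1 - dep) p.2 e)%:Z.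
Proof.
elim: dep e => [|d IH] e dn al H.
  by rewrite subn0 H; apply: eq_bigr => p _; rewrite subn0.
have al' : all (fun p => d <= p.1)%N l by apply: sub_all al => p; exact: ltnW.
move: e; apply: psum_inj => e.
rewrite -kcoef_psum; last by lia.
rewrite subnSK // IH // ?(ltnW dn) // psum_sum.
rewrite !big_seq; apply: eq_bigr => p pl.
by rewrite -hilb_shiftS subnSK // (allP al).
Qed.

(** Newton expansion at degree [n]: [kcoef (g - j) k n] is the [j]-th backward difference of the
    coefficients, and for [g = 0] nothing is left beyond degree [n]. *)
Lemma kcoef_tail g k e : (g <= n)%N ->
  (if (n < e)%N then kcoef g k e else 0) =
  \sum_(j < g) kcoef (g - j) k n * (hilb_shift j.+1 n.+1 e)%:Z.
Proof.
elim: g e => [|g IH] e gn.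
  by rewrite big_ord0; case: ifP => // /kcoef0_gt ->.
rewrite big_ord_recl subn0 hilb_shiftS -psumZ.
have -> : \sum_(i < g) kcoef (g.+1 - lift ord0 i) k n * (hilb_shift (lift ord0 i).+1 n.+1 e)%:Z
  = psum (fun e => if (n < e)%N then kcoef g k e else 0) e.
  rewrite (eq_psum (v := fun e => \sum_(j < g) kcoef (g - j) k n * (hilb_shift j.+1 n.+1 e)%:Z)).
    rewrite psum_sum; apply: eq_bigr => i _.
    by rewrite /= /bump leq0n add1n subSS hilb_shiftS -psumZ.
  by move=> e'; exact: IH (ltnW gn).
rewrite -psumD; elim: e => [|e IHe]; first by rewrite psum0 /hilb_shift mulr0.
rewrite psumS -IHe ltnS leq_eqVlt /hilb_shift ltnS.
case: eqP => [<-|/eqP ne] /=.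
  by rewrite ltnn leqnn subnn hilbn0 mulr1 add0r kcoef_psum // psumS -kcoef_psum.
case: ltnP => ltne; last first.
  by rewrite (_ : (n <= e)%N = false) ?mulr0 ?addr0 //; lia.
rewrite (ltnW ltne) hilb0n subn_eq0 (_ : (e.+1 <= n.+1)%N = false) ?mulr0 ?add0r; last by lia.
by rewrite !kcoef_psum // psumS.
Qed.

(** Cut at degree [n] and divide [d] times by [1 - T]: each coefficient up to [n] becomes the
    multiplicity of a shifted polynomial ring in [d] variables, and the tail summands gain [d]
    variables. *)
Lemma kcoef_decomp g k d e : (g + d <= n)%N ->
  kcoef (g + d) k e = \sum_(s < n.+1) kcoef g k s * (hilb_shift d s e)%:Z
   + \sum_(j < g) kcoef (g - j) k n * (hilb_shift (d + j.+1) n.+1 e)%:Z.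
Proof.
elim: d e => [|d IH] e gd.
  rewrite addn0 in gd *; rewrite -[X in _ + X](kcoef_tail k e gd).
  case: (leqP e n) => en.
    rewrite addr0 (bigD1 (inord e)) //= inordK //.
    have -> : hilb_shift 0 e e = 1%N by rewrite /hilb_shift leqnn subnn.
    rewrite mulr1 big1 ?addr0 // => i ie; rewrite /hilb_shift hilb0n subn_eq0.
    case: leqP => ile; last by rewrite mulr0.
    case: leqP => [eli|_]; last by rewrite mulr0.
    by move/eqP: ie; case; apply: ord_inj; rewrite inordK //; lia.
  rewrite big1 ?add0r // => i _; rewrite /hilb_shift hilb0n subn_eq0.
  have lti := ltn_ord i; case: (leqP i e) => [_|_]; last by rewrite mulr0.
  by case: (leqP e i) => [ei|_]; [lia|rewrite mulr0].
rewrite addnS kcoef_psum; last by lia.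
rewrite (eq_psum (fun e => IH e _)); last by lia.
rewrite psumD !psum_sum; congr (_ + _); apply: eq_bigr => i _; rewrite psumZ.
  by rewrite -hilb_shiftS.
by rewrite addSn hilb_shiftS.
Qed.

Lemma kcoef_decomposition g k : (0 < g)%N -> (g <= n)%N ->
  (forall e, (e <= n - g)%N -> 0 <= kcoef g k e) ->
  exists l : seq (nat * nat), all (fun p => n - g <= p.1 <= n)%N l /\
    forall e, kcoef n k e = \sum_(p <- l) (hilb_shift p.1 p.2 e)%:Z.
Proof.
move=> g0 gn H.
have H1 e : 0 <= kcoef g k e.
  by case: (leqP e (n - g)) => he; [exact: H|exact: kcoef_tail_ge0].
(* As [g - j] is positive, degree [n] lies beyond [n - (g - j)]. *)
have H2 (j : 'I_g) : 0 <= kcoef (g - j) k n.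
  by have := ltn_ord j => jg; apply: kcoef_tail_ge0; lia.
exists (flatten [seq nseq `|kcoef g k (val s)|%N (n - g, val s)%N | s : 'I_n.+1]
  ++ flatten [seq nseq `|kcoef (g - val j) k n|%N (n - g + j.+1, n.+1)%N | j : 'I_g]).
split.
  rewrite all_cat; apply/andP; split; apply/allP => p /flattenP [s /mapP [i _ ->]] /nseqP [-> _] /=.
    by rewrite leqnn leq_subr.
  by have := ltn_ord i; lia.
move=> e; rewrite big_cat /= -[in LHS](subnKC gn) kcoef_decomp ?subnKC //.
congr (_ + _); rewrite big_flatten big_map big_enum /=; apply: eq_bigr => i _.
  by rewrite big_nseq iter_addr_0 -mulr_natl natz gez0_abs.
by rewrite big_nseq iter_addr_0 -mulr_natl natz gez0_abs.
Qed.

(** For this parity [C(n - g, e)] enters with a minus sign, so a nonnegative coefficient bounds it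
    by the sum of the [k + 1] terms [t_j], the largest of which is [t_k]. *)
Lemma kcoef_odd_bound g k e : (0 < g)%N -> odd (k.+1 + e) ->
  (k.+1 * (e - k + g.-1) < (n - k) * (e - k))%N ->
  0 <= kcoef g k.+1 e -> ('C(n - g, e) <= k.+1 * kterm g k e)%N.
Proof.
move=> g0 oke Hr; have := alt_tail_ub g k.+1 e.
rewrite /alt_tail -signr_odd oke expr1 mulN1r opprK => Hub H0.
have mono j : (j <= k)%N -> (kterm g j e <= kterm g k e)%N.
  move=> jk; have [m] := ubnP (k - j); elim: m j jk => // m IH j jk jm.
  move: jk; rewrite leq_eqVlt => /orP [/eqP -> //|jk].
  apply: (leq_trans (n := kterm g j.+1 e)); last by apply: IH => //; lia.
  by apply: kterm_ge_next => //; apply: (kterm_rise_all g0 Hr); exact: ltnW.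
have : \sum_(j < k.+1) (kterm g j e)%:Z <= \sum_(j < k.+1) (kterm g k e)%:Z.
  by apply: ler_sum => j _; rewrite lez_nat mono // -ltnS.
rewrite sumr_const card_ord -mulr_natl natz -PoszM => Hs.
have := le_trans Hub Hs; have := ler_norm (kcoef g k.+1 e + ('C(n - g, e))%:Z).
by move: H0; lia.
Qed.

End KoszulNumbers.

(** * Dimensions *)

Section Bases.
Variable K : fieldType.

(** The graded pieces are predicates on infinite-dimensional spaces, so bases are taken relative to
    a predicate. That [P] is a subspace follows ([basis_lin], [basis_zero]). *)
Definition is_basis (V : lmodType K) (T : finType) (P : V -> Prop) (b : T -> V) : Prop :=
  [/\ forall c : T -> K, P (\sum_t c t *: b t),
      forall x, P x -> exists c : T -> K, x = \sum_t c t *: b t &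
      forall c : T -> K, \sum_t c t *: b t = 0 -> forall t, c t = 0].

Definition has_dim (V : lmodType K) (P : V -> Prop) (m : nat) : Prop :=
  exists b : 'I_m -> V, is_basis P b.

Lemma sum_delta (V : lmodType K) (T : finType) (b : T -> V) t0 :
  \sum_t (t == t0)%:R *: b t = b t0.
Proof.
rewrite (bigD1 t0) //= eqxx scale1r big1 ?addr0 // => t /negbTE ->.
by rewrite scale0r.
Qed.

Section OneBasis.
Variables (V : lmodType K) (T : finType) (P : V -> Prop) (b : T -> V).
Hypothesis bP : is_basis P b.

Lemma basis_mem t : P (b t).
Proof. by case: bP => H _ _; rewrite -(sum_delta b t). Qed.

Lemma basis_lin a x y : P x -> P y -> P (a *: x + y).
Proof.
case: bP => H1 H2 _ /H2 [c ->] /H2 [d ->].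
rewrite scaler_sumr -big_split /=.
rewrite (eq_bigr (fun t => (a * c t + d t) *: b t)) // => t _.
by rewrite scalerDl scalerA.
Qed.

Lemma basis_zero : P 0.
Proof.
case: bP => H _ _; have := H (fun=> 0); rewrite big1 // => t _; exact: scale0r.
Qed.

Lemma basis_coord_inj (c d : T -> K) :
  \sum_t c t *: b t = \sum_t d t *: b t -> c =1 d.
Proof.
case: bP => _ _ H3 E t; apply/eqP; rewrite -subr_eq0; apply/eqP.
apply: (H3 (fun t => c t - d t)); rewrite -[RHS](subrr (\sum_t d t *: b t)) -{1}E -sumrB.
by apply: eq_bigr => s _; rewrite scalerBl.
Qed.

Lemma basis_reindex (T' : finType) (s : T' -> T) : bijective s -> is_basis P (b \o s).
Proof.
case=> s' sK s'K; have bs : bijective s by exists s'.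
have bs' : bijective s' by exists s.
case: bP => H1 H2 H3; split.
- move=> c; rewrite (reindex s' (onW_bij _ bs')) /=.
  by rewrite (eq_bigr (fun t => c (s' t) *: b t)) // => t _; rewrite s'K.
- move=> x /H2 [c ->]; exists (c \o s); by rewrite (reindex s (onW_bij _ bs)).
- move=> c; rewrite (reindex s' (onW_bij _ bs')) /=.
  rewrite (eq_bigr (fun t => c (s' t) *: b t)) => [|t _]; last by rewrite s'K.
  by move=> /(H3 (c \o s')) H t; rewrite -(sK t); exact: H.
Qed.

Lemma basis_has_dim : has_dim P #|T|.
Proof.
exists (b \o enum_val); apply: basis_reindex; exists enum_rank; [exact: enum_valK|exact: enum_rankK].
Qed.

End OneBasis.

(** The matrices expressing each basis in the other have the identity as product, which bounds the
    size by [mulmx1_min]. *)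
Lemma basis_card_le (V : lmodType K) (T1 T2 : finType) (P : V -> Prop) (b1 : T1 -> V) (b2 : T2 -> V) :
  is_basis P b1 -> is_basis P b2 -> (#|T1| <= #|T2|)%N.
Proof.
move=> B1 B2; case: (B1) (B2) => _ s1 _ [_ s2 _].
have [A EA] := fin_all_exists (fun t => s2 _ (basis_mem B1 t)).
have [A' EA'] := fin_all_exists (fun t => s1 _ (basis_mem B2 t)).
apply: (@mulmx1_min K #|T1| #|T2| (\matrix_(i, j) A (enum_val i) (enum_val j))
          (\matrix_(i, j) A' (enum_val i) (enum_val j))).
apply/matrixP => i j; rewrite !mxE.
under eq_bigr do rewrite !mxE.
rewrite -(big_enum_val (A := T2) (fun s => A (enum_val i) s * A' s (enum_val j))) /=.
have -> : (i == j)%:R = (enum_val j == enum_val i)%:R :> K.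
  by rewrite (inj_eq enum_val_inj) eq_sym.
apply: (basis_coord_inj B1 (c := fun t => \sum_s A (enum_val i) s * A' s t)
         (d := fun t => (t == enum_val i)%:R)).
rewrite sum_delta EA; under [RHS]eq_bigr => s _ do rewrite EA' scaler_sumr.
rewrite exchange_big /=; apply: eq_bigr => t _; rewrite scaler_suml.
by apply: eq_bigr => s _; rewrite scalerA.
Qed.

Lemma has_dim_uniq (V : lmodType K) (P : V -> Prop) m m' :
  has_dim P m -> has_dim P m' -> m = m'.
Proof.
move=> [b B] [b' B']; apply/eqP; rewrite eqn_leq.
by have := basis_card_le B B'; have := basis_card_le B' B; rewrite !card_ord => -> ->.
Qed.

Definition linear_on (V W : lmodType K) (P : V -> Prop) (phi : V -> W) : Prop :=
  forall (a : K) x y, P x -> P y -> phi (a *: x + y) = a *: phi x + phi y.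

Lemma linear_on0 (V W : lmodType K) (P : V -> Prop) (phi : V -> W) :
  linear_on P phi -> P 0 -> phi 0 = 0.
Proof.
move=> lin P0; have := lin 1 0 0 P0 P0; rewrite !scale1r addr0 => /eqP.
by rewrite -subr_eq0 opprD addNKr oppr_eq0 => /eqP.
Qed.

Lemma has_dim_map (V W : lmodType K) (P : V -> Prop) (Q : W -> Prop) (phi : V -> W) m :
  linear_on P phi -> (forall x, P x -> Q (phi x)) ->
  (forall x y, P x -> P y -> phi x = phi y -> x = y) ->
  (forall z, Q z -> exists2 x, P x & phi x = z) -> has_dim P m -> has_dim Q m.
Proof.
move=> lin into inj onto [b B]; exists (phi \o b).
have E c : phi (\sum_t c t *: b t) = \sum_t c t *: phi (b t).
  suff [] : P (\sum_t c t *: b t) /\ phi (\sum_t c t *: b t) = \sum_t c t *: phi (b t) by [].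
  elim/big_rec2: _ => [|t x y _ [Py <-]].
    by split; [exact: basis_zero B|apply: linear_on0 lin (basis_zero B)].
  split; first by apply: (basis_lin B) => //; exact: basis_mem B t.
  by rewrite lin //; exact: basis_mem B t.
case: (B) => H1 H2 H3; split.
- by move=> c; rewrite /= -E; apply: into.
- by move=> z /onto [x /H2 [c ->] <-]; exists c; rewrite E.
- move=> c; rewrite /= -E => E0; apply: H3; apply: inj; rewrite ?E0 ?(linear_on0 lin) //; exact: basis_zero B.
Qed.

Lemma has_dim_iso (V W : lmodType K) (P : V -> Prop) (Q : W -> Prop) m :
  has_dim P m -> has_dim Q m ->
  exists phi : V -> W, [/\ linear_on P phi, forall x, P x -> Q (phi x),
    forall x y, P x -> P y -> phi x = phi y -> x = y &
    forall z, Q z -> exists2 x, P x & phi x = z].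
Proof.
move=> [b B] [b' B']; case: (B) (B') => H1 H2 H3 [H1' H2' H3'].
(* The map must be total, so coordinates outside [P] are set to 0. *)
have ex x : exists c : 'I_m -> K, P x -> x = \sum_t c t *: b t.
  by case: (classic (P x)) => [/H2 [c ->]|n]; [exists c|exists (fun=> 0)].
pose co x := proj1_sig (constructive_indefinite_description _ (ex x)).
have coE x : P x -> x = \sum_t co x t *: b t.
  exact: proj2_sig (constructive_indefinite_description _ (ex x)).
exists (fun x => \sum_t co x t *: b' t); split.
- move=> a x y Px Py.
  have : co (a *: x + y) =1 (fun t => a * co x t + co y t).
    apply: (basis_coord_inj B); rewrite -coE; last exact: (basis_lin B).
    rewrite [LHS](congr2 (fun u v => a *: u + v) (coE x Px) (coE y Py)) scaler_sumr -big_split /=.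
    by apply: eq_bigr => t _; rewrite scalerDl scalerA.
  move=> E; rewrite scaler_sumr -big_split /=; apply: eq_bigr => t _.
  by rewrite E scalerDl scalerA.
- by move=> x _; exact: H1'.
- move=> x y Px Py /(basis_coord_inj B') E.
  by rewrite (coE x Px) (coE y Py); apply: eq_bigr => t _; rewrite E.
- move=> z /H2' [c ->]; exists (\sum_t c t *: b t) => //.
  have E := basis_coord_inj B (coE _ (H1 c)).
  by apply: eq_bigr => t _; rewrite E.
Qed.

Lemma has_dim0 (V : lmodType K) (P : V -> Prop) : (forall x, P x <-> x = 0) -> has_dim P 0.
Proof.
move=> H; exists (fun=> 0); split.
- by move=> c; apply/H; rewrite big_ord0.
- by move=> x /H ->; exists (fun=> 0); rewrite big_ord0.
- by move=> c _ [].
Qed.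

Lemma has_dim_prod (V : lmodType K) N (P : 'I_N -> V -> Prop) (m : 'I_N -> nat) :
  (forall i, has_dim (P i) (m i)) ->
  has_dim (fun z : {ffun 'I_N -> V} => forall i, P i (z i)) (\sum_i m i)%N.
Proof.
move=> H; have [b B] := fin_all_exists H.
pose bb (u : {i : 'I_N & 'I_(m i)}) : {ffun 'I_N -> V} :=
  [ffun j => if j == tag u then b (tag u) (tagged u) else 0].
have E (c : {i : 'I_N & 'I_(m i)} -> K) j :
  (\sum_u c u *: bb u) j = \sum_(t : 'I_(m j)) c (Tagged _ t) *: b j t.
  rewrite sum_ffunE.
  pose F i (t : 'I_(m i)) := ((c (Tagged _ t) *: bb (Tagged _ t)) : {ffun 'I_N -> V}) j.
  transitivity (\sum_(p : {i : 'I_N & 'I_(m i)}) F (tag p) (tagged p)).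
    by apply: eq_bigr => -[i t] _.
  rewrite -(sig_big_dep xpredT (fun _ => xpredT) F) (bigD1 j) //= [X in _ + X]big1 => [|i ij].
    by rewrite /= addr0; apply: eq_bigr => t _; rewrite /F !ffunE /= eqxx.
  by rewrite big1 // => t _; rewrite /F !ffunE /= eq_sym (negbTE ij) scaler0.
have BB : is_basis (fun z : {ffun 'I_N -> V} => forall i, P i (z i)) bb.
  split.
  - by move=> c j; rewrite E; case: (B j).
  - move=> z Hz.
    have Hex i : exists c : 'I_(m i) -> K, z i = \sum_t c t *: b i t by case: (B i) => _ + _; apply.
    have [c Ec] := fin_all_exists Hex.
    exists (fun u => c (tag u) (tagged u)); apply/ffunP => j; by rewrite E Ec.
  - move=> c E0 [j t]; case: (B j) => _ _ /(_ (fun t => c (existT _ j t))); apply.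
    by rewrite -E E0 ffunE.
have := basis_has_dim BB; rewrite card_tagged sumnE big_map big_enum /=.
by rewrite (eq_bigr m) // => i _; rewrite card_ord.
Qed.

(** The difference of [x] and the sum of the [l t x *: b t] is killed by all functionals, hence
    0. *)
Lemma basis_of_dual (V : lmodType K) (T : finType) (P : V -> Prop) (b : T -> V) (l : T -> V -> K) :
  (forall t a x y, l t (a *: x + y) = a * l t x + l t y) ->
  P 0 -> (forall a x y, P x -> P y -> P (a *: x + y)) -> (forall t, P (b t)) ->
  (forall s t, l s (b t) = (s == t)%:R) ->
  (forall x, P x -> (forall t, l t x = 0) -> x = 0) -> is_basis P b.
Proof.
move=> lin P0 PD Pb dual sep.
have l0 t : l t 0 = 0.
  by have := lin t 1 0 0; rewrite scale1r addr0 mul1r => /eqP; rewrite -subr_eq0 opprD addNKr oppr_eq0 => /eqP.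
have PS (c : T -> K) : P (\sum_t c t *: b t).
  by elim/big_rec: _ => // t x _ Px; exact: PD.
have lS (c : T -> K) s : l s (\sum_t c t *: b t) = c s.
  transitivity (\sum_t c t * (s == t)%:R).
    by elim/big_rec2: _ => // t x y _ <-; rewrite lin dual.
  rewrite (bigD1 s) //= eqxx mulr1 big1 ?addr0 // => t; rewrite eq_sym => /negbTE ->; exact: mulr0.
split => //.
- move=> x Px; exists (l^~ x); apply/eqP; rewrite eq_sym -subr_eq0; apply/eqP; apply: sep.
    by rewrite addrC -scaleN1r; apply: PD.
  by move=> t; rewrite addrC -scaleN1r lin lS mulN1r addNr.
- by move=> c E t; rewrite -(lS c) E.
Qed.

End Bases.

Lemma card_mdeg n B j : (j < B)%N -> #|[pred c : 'X_{1..n < B} | mdeg c == j]| = hilb n j.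
Proof.
move=> jB; case: n => [|n].
  have Z (c : 'X_{1..0}) : c = 0%MM by apply/mnmP => -[].
  rewrite hilb0n; case: eqP => [j0|/eqP j0].
    have b0 : (mdeg (0%MM : 'X_{1..0}) < B)%N by rewrite mdeg0; lia.
    transitivity #|pred1 (BMultinom b0)|; last by rewrite card1.
    apply: eq_card => c; rewrite !inE.
    rewrite (Z c) mdeg0 j0 eqxx; apply/esym/eqP; apply: val_inj; exact: Z.
  rewrite (eq_card (B := pred0)) ?card0 // => c.
  by rewrite !inE (Z c) mdeg0 eq_sym (negbTE j0).
rewrite /hilb addnS /= -size_basis cardE -(size_map val).
apply: perm_size; apply: uniq_perm.
- by rewrite (map_inj_uniq val_inj) enum_uniq.
- exact: uniq_basis.
move=> m; rewrite -basis_cover; apply/mapP/eqP => [[c]|mj].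
  by rewrite mem_enum inE => /eqP <- ->.
have mB : (mdeg m < B)%N by rewrite mj.
by exists (BMultinom mB); rewrite ?mem_enum ?inE /= ?mj.
Qed.

(** * Hilbert functions of graded retracts *)

Section Retract.
Variable K : fieldType.

Definition lforms m n (A : 'M[K]_(m, n)) : m.-tuple {mpoly K[n]} := [tuple lin_form A i | i < m].

Lemma lin_form_homog m n (A : 'M[K]_(m, n)) i : lin_form A i \is 1.-homog.
Proof.
by rewrite /lin_form; apply: rpred_sum => j _; apply: rpredZ; rewrite dhomogX /= mdeg1.
Qed.

Lemma comp_lforms_homog m n (A : 'M[K]_(m, n)) j (q : {mpoly K[m]}) :
  q \is j.-homog -> q \mPo lforms A \is j.-homog.
Proof.
move=> hq; rewrite comp_mpolyEX big_seq; apply: rpred_sum => c cq; apply: rpredZ.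
have <- : mdeg c = j by exact: dhomog_mf hq _ cq.
rewrite comp_mpolyX mdegE.
apply: (big_ind2 (fun (p : {mpoly K[n]}) d => p \is d.-homog)).
- exact: dhomog1.
- by move=> p d p' d' hp hp'; exact: dhomogM.
- by move=> i _; rewrite tnth_mktuple; have := dhomogMn (c i) (lin_form_homog A i); rewrite mul1n.
Qed.

Lemma comp_lforms_lin_form m p n (C : 'M[K]_(p, m)) (A : 'M[K]_(m, n)) i :
  lin_form C i \mPo lforms A = lin_form (C *m A) i.
Proof.
rewrite /lin_form raddf_sum /=.
under [RHS]eq_bigr => j _ do rewrite mxE scaler_suml.
rewrite exchange_big /=; apply: eq_bigr => l _.
rewrite linearZ /= comp_mpolyXU -tnth_nth tnth_mktuple /lin_form scaler_sumr.
by apply: eq_bigr => j _; rewrite scalerA.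
Qed.

Lemma comp_lformsM m p n (C : 'M[K]_(p, m)) (A : 'M[K]_(m, n)) (q : {mpoly K[p]}) :
  (q \mPo lforms C) \mPo lforms A = q \mPo lforms (C *m A).
Proof.
rewrite [q]mpolyE (raddf_sum (comp_mpoly (lforms C))) (raddf_sum (comp_mpoly (lforms A))).
rewrite (raddf_sum (comp_mpoly (lforms (C *m A)))) /=; apply: eq_bigr => c _.
rewrite !comp_mpolyZ !comp_mpolyX rmorph_prod /=; congr (_ *: _).
by apply: eq_bigr => i _; rewrite rmorphXn /= !tnth_mktuple comp_lforms_lin_form.
Qed.

Lemma comp_lforms1 n (q : {mpoly K[n]}) : q \mPo lforms 1%:M = q.
Proof.
rewrite -[RHS]comp_mpoly_id; congr (_ \mPo _); apply: eq_from_tnth => i.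
rewrite !tnth_mktuple /lin_form (bigD1 i) //= mxE eqxx scale1r big1 ?addr0 // => j ji.
by rewrite mxE eq_sym (negbTE ji) scale0r.
Qed.

Lemma mnm_pos_ex m (c : 'X_{1..m}) : mdeg c != 0%N -> exists i, (0 < c i)%N.
Proof.
rewrite mdeg_eq0 => c0; apply/existsP; apply: contraR c0; rewrite negb_exists => /forallP H.
by apply/eqP/mnmP => i; rewrite mnm0E; apply/eqP; rewrite -leqn0 leqNgt.
Qed.

Lemma mnm_subU m (c : 'X_{1..m}) i : (0 < c i)%N -> (U_(i) + (c - U_(i)) = c)%MM.
Proof.
move=> ci; apply/mnmP => j; rewrite mnmDE mnmBE mnm1E.
by case: eqP => [<-|_]; rewrite ?subn0 //; lia.
Qed.

Lemma mdeg_subU m (c : 'X_{1..m}) i : (0 < c i)%N -> mdeg (c - U_(i)) = (mdeg c).-1.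
Proof. by move=> ci; rewrite -{2}(mnm_subU ci) mdegD mdeg1. Qed.

Lemma monomial_tuple m (c : 'X_{1..m}) j : mdeg c = j ->
  exists t : j.-tuple 'I_m, 'X_[c] = \prod_(i <- t) 'X_i :> {mpoly K[m]}.
Proof.
elim: j c => [|j IH] c cj.
  move/eqP: cj; rewrite mdeg_eq0 => /eqP ->.
  by exists [tuple]; rewrite big_nil mpolyX0.
have [i ci] : exists i, (0 < c i)%N by apply: mnm_pos_ex; rewrite cj.
have [t Et] : exists t : j.-tuple 'I_m, 'X_[c - U_(i)] = \prod_(i <- t) 'X_i :> {mpoly K[m]}.
  by apply: IH; rewrite mdeg_subU // cj.
by exists [tuple of i :: t]; rewrite big_cons -Et -mpolyXD mnm_subU.
Qed.

(** Products of [j] generators are the values of the monomials of degree [j] under substitution of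
    the linear forms. *)
Lemma retract_comp m n (A : 'M[K]_(m, n)) j p :
  in_retract_deg A j%:Z p <-> exists2 q : {mpoly K[m]}, q \is j.-homog & p = q \mPo lforms A.
Proof.
split.
  case=> [->|[j' [<-] [c ->]]]; first by exists 0; rewrite ?dhomog0 ?comp_mpoly0.
  exists (\sum_(t : j.-tuple 'I_m) c t *: \prod_(l < j) 'X_(tnth t l)).
    apply: rpred_sum => t _; apply: rpredZ; rewrite -(big_tuple _ _ t xpredT (fun i => 'X_i)).
    rewrite mprodXE dhomogX /= mdeg_sum.
    by under eq_bigr => i _ do rewrite mdeg1; rewrite sum1_size size_tuple.
  rewrite raddf_sum /=; apply: eq_bigr => t _; rewrite linearZ /= rmorph_prod /=.
  by congr (_ *: _); apply: eq_bigr => l _; rewrite comp_mpolyXU -tnth_nth tnth_mktuple.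
case=> q hq ->; right; exists j => //; rewrite comp_mpolyEX big_seq.
elim/big_rec: _ => [|c x cq [d ->]].
  by exists [ffun=> 0]; rewrite big1 // => t _; rewrite ffunE scale0r.
have [t ->] := monomial_tuple (dhomog_mf hq cq : mdeg c = j).
exists [ffun u => (u == t)%:R * q@_c + d u].
under [RHS]eq_bigr => u _ do rewrite ffunE scalerDl -scalerA.
rewrite big_split /= sum_delta; congr (_ *: _ + _); rewrite rmorph_prod /= big_tuple.
by apply: eq_bigr => l _; rewrite comp_mpolyXU -tnth_nth tnth_mktuple.
Qed.

Lemma retract_sub m p n (C : 'M[K]_(p, m)) (A : 'M[K]_(m, n)) j x :
  in_retract_deg (C *m A) j%:Z x -> in_retract_deg A j%:Z x.
Proof.
case/retract_comp => q hq ->; apply/retract_comp; exists (q \mPo lforms C).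
  exact: comp_lforms_homog.
by rewrite comp_lformsM.
Qed.

(** Each of [A] and [row_base A] is a left multiple of the other, so the generators may be taken
    linearly independent. *)
Lemma retract_row_base m n (A : 'M[K]_(m, n)) j x :
  in_retract_deg (row_base A) j%:Z x <-> in_retract_deg A j%:Z x.
Proof.
have /submxP [D1 E1] : (row_base A <= A)%MS by rewrite eq_row_base.
have /submxP [D2 E2] : (A <= row_base A)%MS by rewrite eq_row_base.
split; first by rewrite E1; exact: retract_sub.
by rewrite {1}E2; exact: retract_sub.
Qed.

(** A right inverse of [A] undoes the substitution, so independent linear forms generate a
    polynomial ring. *)
Lemma homog_has_dim_free m n (A : 'M[K]_(m, n)) j : row_free A ->
  has_dim (in_retract_deg A j%:Z) (hilb m j).
Proof.
case/row_freeP => C AC.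
have inj : injective (fun q : {mpoly K[m]} => q \mPo lforms A).
  by move=> p q /(congr1 (fun x => x \mPo lforms C)); rewrite !comp_lformsM AC !comp_lforms1.
pose T := {c : 'X_{1..m < j.+1} | mdeg c == j}.
rewrite -(card_mdeg m (ltnSn j)) -card_sig.
pose b (t : T) : {mpoly K[n]} := 'X_[val (val t)] \mPo lforms A.
have ES (c : T -> K) : \sum_t c t *: b t = (\sum_t c t *: 'X_[val (val t)]) \mPo lforms A.
  by rewrite raddf_sum /=; apply: eq_bigr => t _; rewrite linearZ.
have co (c : T -> K) s : (\sum_t c t *: 'X_[val (val t)])@_(val (val s)) = c s.
  rewrite raddf_sum /= (bigD1 s) //= mcoeffZ mcoeffX eqxx mulr1 big1 ?addr0 // => t ts.
  by rewrite mcoeffZ mcoeffX (inj_eq val_inj) (inj_eq val_inj) (negbTE ts) mulr0.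
apply: (basis_has_dim (b := b)); split.
- move=> c; apply/retract_comp; rewrite ES; eexists; last by [].
  by apply: rpred_sum => t _; apply: rpredZ; rewrite dhomogX (valP t).
- move=> x /retract_comp [q hq ->]; exists (fun t => q@_(val (val t))); rewrite ES; congr (_ \mPo _).
  apply/mpolyP => c; case: (eqVneq (mdeg c) j) => cj.
    have cB : (mdeg c < j.+1)%N by rewrite cj.
    have cT : mdeg (BMultinom cB) == j by rewrite /= cj.
    by rewrite -[c in RHS]/(val (val (Sub (BMultinom cB) cT : T))) co.
  rewrite (dhomog_nemf_coeff hq cj) (@dhomog_nemf_coeff _ _ mdeg j) //.
  by apply: rpred_sum => t _; apply: rpredZ; rewrite dhomogX (valP t).
- move=> c E t; rewrite -(co c t).
  have -> : \sum_t c t *: 'X_[val (val t)] = 0 :> {mpoly K[m]}.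
    by apply: inj; rewrite -ES E comp_mpoly0.
  by rewrite mcoeff0.
Qed.

Lemma eq_has_dim (V : lmodType K) (P Q : V -> Prop) m :
  (forall x, P x <-> Q x) -> has_dim P m -> has_dim Q m.
Proof.
move=> E [b [H1 H2 H3]]; exists b; split=> //.
- by move=> c; apply/E.
- by move=> x /E; exact: H2.
Qed.

Lemma retract_neg m n (A : 'M[K]_(m, n)) (e : int) x : e < 0 -> in_retract_deg A e x <-> x = 0.
Proof. by move=> e0; split=> [[//|[j E]]|]; [move: e0; rewrite E|left]. Qed.

Lemma retract_has_dim m n (A : 'M[K]_(m, n)) (e s : nat) :
  has_dim (in_retract_deg A (e%:Z - s%:Z)) (hilb_shift (\rank A) s e).
Proof.
rewrite /hilb_shift; case: leqP => se; last by apply: has_dim0 => x; apply: retract_neg; lia.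
rewrite (_ : e%:Z - s%:Z = (e - s)%N%:Z); last by lia.
apply: (eq_has_dim (retract_row_base A (e - s))).
by apply: homog_has_dim_free; exact: row_base_free.
Qed.

End Retract.

(** * The Hilbert function of the Koszul syzygies *)

Section Koszul.
Variables (K : fieldType) (n : nat).
Local Notation wedge := (wedge K n).

Lemma mcoeffXM (p : {mpoly K[n]}) i c :
  ('X_i * p)@_c = if (0 < c i)%N then p@_(c - U_(i)) else 0.
Proof.
rewrite mulrC; case: ltnP => ci; first by rewrite -{1}(mnm_subU ci) mcoeffMX.
rewrite {1}[p]mpolyE mulr_suml raddf_sum /= big1 // => m _.
rewrite -scalerAl -mpolyXD mcoeffZ mcoeffX; case: eqP => [E|_]; rewrite ?mulr0 //.
by move: ci; rewrite -E mnmDE mnm1E eqxx addn1.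
Qed.

Lemma mcoeff_sign (p : {mpoly K[n]}) a c : ((-1) ^+ a * p)@_c = (-1) ^+ a * p@_c.
Proof. by rewrite -[in LHS]signr_odd -[in RHS]signr_odd !mulr_sign; case: ifP => _; rewrite ?mcoeffN. Qed.

Definition ksign (J : {set 'I_n}) (i : 'I_n) : nat := #|[set j in J | (j < i)%N]|.

Lemma koszul_dE k (f : wedge) (J : {set 'I_n}) : #|J| = k.-1 ->
  koszul_d k f J = \sum_(i < n | i \notin J) ((-1) ^+ ksign J i * 'X_i * f (i |: J)).
Proof. by move=> E; rewrite ffunE E eqxx. Qed.

Lemma koszul_d_out k (f : wedge) (J : {set 'I_n}) : #|J| != k.-1 -> koszul_d k f J = 0.
Proof. by move=> E; rewrite ffunE (negbTE E). Qed.

Lemma mcoeff_koszul k (f : wedge) (J : {set 'I_n}) c : #|J| = k.-1 ->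
  (koszul_d k f J)@_c = \sum_(i < n | i \notin J)
     (-1) ^+ ksign J i * (if (0 < c i)%N then (f (i |: J))@_(c - U_(i)) else 0).
Proof.
move=> E; rewrite koszul_dE // raddf_sum /=; apply: eq_bigr => i _.
by rewrite -mulrA mcoeff_sign mcoeffXM.
Qed.

Lemma koszul_d_lin k a (f g : wedge) :
  koszul_d k (a *: f + g) = a *: koszul_d k f + koszul_d k g.
Proof.
apply/ffunP => J; rewrite !ffunE; case: ifP => _; last by rewrite scaler0 addr0.
rewrite scaler_sumr -big_split /=; apply: eq_bigr => i _.
by rewrite !ffunE mulrDr scalerAr.
Qed.

Lemma ksignU (J : {set 'I_n}) i j : i \notin J -> ksign (i |: J) j = (ksign J j + (i < j))%N.
Proof.
move=> iJ; rewrite /ksign; case: (ltnP i j) => ij.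
  have -> : [set l in i |: J | (l < j)%N] = i |: [set l in J | (l < j)%N].
    by apply/setP => l; rewrite !inE; case: eqP => [->|].
  by rewrite cardsU1 !inE (negbTE iJ) addnC.
rewrite addn0; congr #|pred_of_set _|; apply/setP => l; rewrite !inE.
by case: eqP => [->|] //=; rewrite (negbTE iJ) ltnNge ij.
Qed.

(** The terms of [(i, j)] and [(j, i)] cancel: inserting the smaller index first raises the sign
    exponent of the larger by one, while the other order changes nothing. *)
Lemma koszul_dd k (f : wedge) : (0 < k)%N -> koszul_d k (koszul_d k.+1 f) = 0.
Proof.
move=> k0; apply/ffunP => J; rewrite [RHS]ffunE.
case: (eqVneq #|J| k.-1) => EJ; last exact: koszul_d_out.
rewrite koszul_dE //.
pose C i j := [&& i \notin J, j \notin J & i != j].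
pose G i j := (-1) ^+ (ksign J i + ksign (i |: J) j) * ('X_i * 'X_j) * f (j |: (i |: J)).
transitivity (\sum_i \sum_(j | C i j) G i j).
  rewrite big_mkcond; apply: eq_bigr => i _; case: ifP => iJ; last first.
    by rewrite big1 // => j; rewrite /C iJ.
  rewrite koszul_dE; last by rewrite cardsU1 iJ EJ; lia.
  rewrite mulr_sumr; apply: eq_big => j; first by rewrite /C !inE iJ negb_or /= andbC eq_sym.
  by move=> _; rewrite /G exprD; ring.
rewrite pair_big_dep /= (bigID (fun p : 'I_n * 'I_n => p.1 < p.2)%N) /=.
rewrite [X in _ + X](reindex_inj (h := fun p : 'I_n * 'I_n => (p.2, p.1))) /=; last first.
  by move=> [a b] [c d] [-> ->].
rewrite [X in _ + X](eq_bigl (fun p : 'I_n * 'I_n => C p.1 p.2 && (p.1 < p.2)%N)); last first.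
  move=> [i j] /=; rewrite /C -leqNgt ltn_neqAle.
  rewrite [in j == i]eq_sym -(inj_eq val_inj) /=.
  by case: (i \notin J); case: (j \notin J); case: (nat_of_ord i == j).
rewrite -big_split /= big1 // => -[i j] /= /andP [/and3P [iJ jJ ij] lij].
rewrite /G !ksignU // lij ltnNge (ltnW lij) /= addn0 addn1 setUCA.
rewrite (mulrC 'X_j) [(ksign J j + _)%N]addnC addnS exprS mulN1r.
by ring.
Qed.

Definition isfirst (c : 'X_{1..n}) (i : 'I_n) : bool :=
  (0 < c i)%N && [forall i' : 'I_n, (i' < i)%N ==> (c i' == 0%N)].

(* The coordinates [(J, c)], i.e. [x^c e_J], that determine the elements of [M(n, k)]. *)
Definition special (J : {set 'I_n}) (c : 'X_{1..n}) : bool :=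
  [exists i, isfirst c i && [forall j in J, (i < j)%N]].

Lemma isfirst_gt0 c i : isfirst c i -> (0 < c i)%N.
Proof. by case/andP. Qed.

Lemma isfirst_le c i i' : isfirst c i -> (0 < c i')%N -> (i <= i')%N.
Proof.
case/andP => _ /forallP /(_ i') /implyP H ci'; rewrite leqNgt; apply/negP => /H.
by move/eqP => E; rewrite E in ci'.
Qed.

Lemma isfirst_uniq c i i' : isfirst c i -> isfirst c i' -> i = i'.
Proof.
move=> h h'; apply/val_inj/eqP; rewrite /= eqn_leq.
by rewrite (isfirst_le h (isfirst_gt0 h')) (isfirst_le h' (isfirst_gt0 h)).
Qed.

Lemma isfirst_ex (c : 'X_{1..n}) i0 : (0 < c i0)%N -> exists i, isfirst c i.
Proof.
move=> ci0; case: (@arg_minnP _ i0 (fun i => 0 < c i)%N (fun i => nat_of_ord i)) => // i ci H.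
exists i; rewrite /isfirst ci; apply/forallP => i'; apply/implyP => lt.
by rewrite -leqn0 leqNgt; apply/negP => /H; rewrite leqNgt lt.
Qed.

Lemma specialP (J : {set 'I_n}) c :
  reflect (exists2 i, isfirst c i & forall j, j \in J -> (i < j)%N) (special J c).
Proof.
apply: (iffP existsP) => [[i /andP [h /forallP H]]|[i h H]]; exists i => //.
  by move=> j jJ; have := H j; rewrite jJ.
by rewrite h; apply/forallP => j; apply/implyP; exact: H.
Qed.

Lemma nonspecial (J : {set 'I_n}) c j1 : j1 \in J -> ~~ special J c ->
  exists2 j0, j0 \in J & (forall j, j \in J -> (j0 <= j)%N) /\ (forall i, (0 < c i)%N -> (j0 <= i)%N).
Proof.
move=> j1J nsp.
case: (@arg_minnP _ j1 (fun j => j \in J) (fun j => nat_of_ord j)) => // j0 j0J H.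
exists j0 => //; split=> // i ci; rewrite leqNgt; apply/negP => lt.
case/negP: nsp; have [i0 h0] := isfirst_ex ci; apply/specialP; exists i0 => // j /H.
by apply: leq_trans; apply: leq_ltn_trans (isfirst_le h0 ci) lt.
Qed.

Definition evec (J : {set 'I_n}) (m : 'X_{1..n}) : wedge :=
  [ffun J' => if J' == J then 'X_[m] else 0].

(** The boundary of [x^c / x_i] at [e_(i |: J)], with [i] minimal in the support of [c]. For special
    [(J, c)] with [#|J| = k] this is the element whose only nonzero special coordinate is [(J, c)].
    For [c = 0] the value is a default. *)
Definition kgen k (J : {set 'I_n}) (c : 'X_{1..n}) : wedge :=
  if [pick i | isfirst c i] is Some i then koszul_d k.+1 (evec (i |: J) (c - U_(i))) else 0.

Lemma kgenE k J c i : isfirst c i -> kgen k J c = koszul_d k.+1 (evec (i |: J) (c - U_(i))).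
Proof.
move=> h; rewrite /kgen; case: pickP => [i' /(isfirst_uniq h) -> //|/(_ i)].
by rewrite h.
Qed.

Lemma kgen_coord k (J : {set 'I_n}) c (J' : {set 'I_n}) c' : #|J'| = k -> special J c -> special J' c' ->
  (kgen k J c J')@_c' = ((J' == J) && (c' == c))%:R.
Proof.
move=> EJ' /specialP [i0 h0 HJ] /specialP [i1 h1 HJ'].
rewrite (kgenE k J h0) mcoeff_koszul //.
have i0J : i0 \notin J by apply/negP => /HJ; rewrite ltnn.
(* If a contributing [i] differed from [i0], then [i0] would lie in [J'] and [i] in [J], so
   [i1 < i0 < i]; but [i1] is [i] or belongs to the support of [c], whose minimum is [i0]. *)
have key i : i \notin J' -> i |: J' = i0 |: J -> (0 < c' i)%N -> (c - U_(i0) = c' - U_(i))%MM ->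
    [/\ i = i0, J' = J & c' = c].
  move=> iJ' E ci Ec.
  have Ec' : c' = (U_(i) + (c - U_(i0)))%MM by rewrite Ec mnm_subU.
  have ii0 : i = i0.
    apply/eqP; apply/negPn/negP => ne.
    have : i0 \in i |: J' by rewrite E setU11.
    rewrite !inE eq_sym (negbTE ne) /= => /HJ' lt1.
    have := isfirst_gt0 h1; rewrite Ec' mnmDE mnm1E; case: eqP => [ii1 _|_].
      have : i \in i0 |: J by rewrite -E setU11.
      rewrite !inE (negbTE ne) /= => /HJ; rewrite ii1 => lt2.
      by have := ltn_trans lt1 lt2; rewrite ltnn.
    rewrite add0n mnmBE => c1; have : (0 < c i1)%N by lia.
    by move/(isfirst_le h0); rewrite leqNgt lt1.
  subst i; split=> //.
    by rewrite -(setU1K iJ') E setU1K.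
  by rewrite Ec' mnm_subU // isfirst_gt0.
case: (boolP ((J' == J) && (c' == c))) => [/andP [/eqP -> /eqP ->]|ne].
  rewrite (bigD1 i0) //= isfirst_gt0 // ffunE eqxx mcoeffX eqxx big1 ?addr0.
    rewrite mulr1 /ksign (_ : [set j in J | (j < i0)%N] = set0) ?cards0 //.
    apply/setP => j; rewrite !inE; apply/negP => /andP [/HJ lt1 lt2].
    by have := ltn_trans lt1 lt2; rewrite ltnn.
  move=> i /andP [iJ ne]; rewrite ffunE; case: eqP => [E|_]; last by rewrite mcoeff0 if_same mulr0.
  have : i \in i0 |: J by rewrite -E setU11.
  by rewrite !inE (negbTE ne) (negbTE iJ).
apply: big1 => i iJ'; rewrite ffunE; case: eqP => [E|_]; last by rewrite mcoeff0 if_same mulr0.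
case: ifP => ci; last by rewrite mulr0.
rewrite mcoeffX; case: eqP => [Ec|_]; last by rewrite mulr0.
by have [_ EJ Ecc] := key i iJ' E ci Ec; case/negP: ne; rewrite EJ Ecc !eqxx.
Qed.

Lemma homog_ofP (p : {mpoly K[n]}) (j : nat) : homog_of p j%:Z <-> p \is j.-homog.
Proof.
split; first by case=> [->|[j' [->]]]; rewrite ?dhomog0.
by move=> h; right; exists j.
Qed.

Lemma kgen_homog k J c j : special J c -> mdeg c = j -> forall J', kgen k J c J' \is j.-homog.
Proof.
move=> /specialP [i0 h0 _] cj J'; rewrite (kgenE k J h0).
case: (eqVneq #|J'| k) => EJ; last by rewrite koszul_d_out ?dhomog0.
rewrite koszul_dE //; apply: rpred_sum => i _; rewrite ffunE.
case: ifP => _; last by rewrite mulr0 dhomog0.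
have : ('X_i * 'X_[c - U_(i0)] : {mpoly K[n]}) \is j.-homog.
  rewrite -mpolyXD dhomogX /= mdegD mdeg1 mdeg_subU ?isfirst_gt0 // add1n.
  by have := isfirst_gt0 h0; rewrite -cj; case E : (mdeg c) => //; move/eqP: E; rewrite mdeg_eq0 => /eqP ->; rewrite mnm0E.
rewrite -mulrA -signr_odd mulr_sign; case: ifP => _ //; by rewrite rpredN.
Qed.

(** For a nonspecial [(J, c)] let [j0] be the minimum of [J]; it is at most every index in the
    support of [c]. The coordinate of the boundary of [x] at [(J :\ j0, c + U_(j0))] is 0. It
    consists of the coordinate of [x] at [(J, c)], up to sign, and of special coordinates of [x],
    which vanish. *)
Lemma special_sep k (x : wedge) : inM k.+1 x ->
  (forall (J : {set 'I_n}) c, #|J| = k -> special J c -> (x J)@_c = 0) -> x = 0.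
Proof.
move=> [f Ex] H; apply/ffunP => J; rewrite [RHS]ffunE.
case: (eqVneq #|J| k) => EJ; last by rewrite Ex koszul_d_out.
apply/mpolyP => c; rewrite mcoeff0; case: (boolP (special J c)) => sp; first exact: H.
(* For [J] empty a nonspecial [c] is 0, and boundaries have no constant coefficients. *)
case: (set_0Vmem J) => [J0|[j1 j1J]].
  rewrite Ex mcoeff_koszul // big1 // => i _; case: ltnP => ci; last by rewrite mulr0.
  case/negP: sp; have [i0 h0] := isfirst_ex ci; apply/specialP; exists i0 => // j.
  by rewrite J0 inE.
have [j0 j0J [Hmin Hc]] := nonspecial j1J sp.
have k0 : (0 < k)%N by rewrite -EJ card_gt0; apply/set0Pn; exists j1.
have : (koszul_d k x (J :\ j0))@_(c + U_(j0)) = 0.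
  by rewrite Ex koszul_dd // ffunE mcoeff0.
have EJ0 : #|J :\ j0| = k.-1 by have := cardsD1 j0 J; rewrite j0J EJ add1n => ->.
rewrite mcoeff_koszul // (bigD1 j0) ?inE ?eqxx //=.
rewrite setD1K // mnmDE mnm1E eqxx addn1 /= (_ : (c + U_(j0) - U_(j0))%MM = c); last first.
  by apply/mnmP => l; rewrite mnmBE mnmDE addnK.
rewrite big1 ?addr0 => [|i /andP []].
  by rewrite -signr_odd mulr_sign; case: ifP => _ // /eqP; rewrite oppr_eq0 => /eqP.
rewrite !inE negb_and negbK => iJ ne; move: iJ; rewrite (negbTE ne) /= => iJ.
rewrite mnmDE mnm1E eq_sym (negbTE ne) addn0; case: ltnP => ci; last by rewrite mulr0.
have lt : (j0 < i)%N.
  by have := Hc i ci; rewrite leq_eqVlt => /orP [/eqP /val_inj E|//]; rewrite E eqxx in ne.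
rewrite H ?mulr0 //.
  by rewrite cardsU1 !inE (negbTE iJ) andbF EJ0 add1n prednK.
apply/specialP; exists j0.
  rewrite /isfirst mnmBE mnmDE !mnm1E eqxx (negbTE ne) subn0 addn1 /=.
  apply/forallP => l; apply/implyP => lj; rewrite mnmBE mnmDE !mnm1E.
  have -> : c l = 0%N by apply/eqP; rewrite -leqn0 leqNgt; apply/negP => /Hc; rewrite leqNgt lj.
  by case: (eqVneq j0 l) => [E|_] //; rewrite E ltnn in lj.
move=> j; rewrite !inE => /orP [/eqP -> //|/andP [jj0 jJ]].
have := Hmin j jJ; rewrite leq_eqVlt => /orP [/eqP /val_inj E|//].
by rewrite E eqxx in jj0.
Qed.

Lemma inM0 k : inM k (0 : wedge).
Proof.
exists 0; apply/ffunP => J; rewrite !ffunE; case: ifP => // _.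
by rewrite big1 // => i _; rewrite ffunE mulr0.
Qed.

Definition specials (B k j : nat) : {set {set 'I_n} * 'X_{1..n < B}} :=
  [set p : {set 'I_n} * 'X_{1..n < B} | [&& #|p.1| == k, mdeg p.2 == j & special p.1 p.2]].

Lemma pair_bmnm_eq B (p q : {set 'I_n} * 'X_{1..n < B}) :
  (p == q) = (p.1 == q.1) && (bmnm p.2 == bmnm q.2).
Proof. by case: p q => [J c] [J' c']; rewrite xpair_eqE (inj_eq val_inj). Qed.

(** The elements [kgen] form a basis with the special coordinates as dual functionals. As [e_J] has
    degree [k], exponents of degree [j] sit in degree [k + j]. *)
Lemma inM_has_dim B k j : (j < B)%N ->
  has_dim (inM_deg (K := K) (n := n) k.+1 (k + j)%N%:Z) #|specials B k j|.
Proof.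
move=> jB.
have dE : (k + j)%N%:Z - (k.+1.-1)%:Z = j%:Z by rewrite PoszD /=; lia.
rewrite -card_sig.
pose T := {p | p \in specials B k j}.
have TP (t : T) : [/\ #|(val t).1| = k, mdeg (val t).2 = j & special (val t).1 (val t).2].
  by have := valP t; rewrite inE => /and3P [/eqP -> /eqP -> ->].
apply: (basis_has_dim (b := fun t : T => kgen k (val t).1 (val (val t).2))).
apply: (basis_of_dual (l := fun (t : T) (x : wedge) => (x (val t).1)@_(val (val t).2))).
- by move=> t a x y; rewrite !ffunE mcoeffD mcoeffZ.
- split; first exact: inM0.
  by move=> J; rewrite ffunE; left.
- move=> a x y [[f ->] hx] [[g ->] hy]; split.
    by exists (a *: f + g); rewrite koszul_d_lin.
  move=> J; move: (hx J) (hy J); rewrite dE => /homog_ofP h1 /homog_ofP h2; apply/homog_ofP.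
  by rewrite ffunE [X in X + _]ffunE; apply: rpredD => //; apply: rpredZ.
- move=> t; have [_ h2 h3] := TP t; split.
    by have /specialP [i hi _] := h3; rewrite (kgenE k _ hi); eexists.
  by move=> J; rewrite dE; apply/homog_ofP; apply: kgen_homog.
- move=> s t; have [s1 s2 s3] := TP s; have [t1 t2 t3] := TP t.
  have E : (s == t) = ((val s).1 == (val t).1) && (bmnm (val s).2 == bmnm (val t).2).
    by rewrite -[LHS](inj_eq val_inj) pair_bmnm_eq.
  by rewrite E (kgen_coord s1 t3 s3).
- move=> x [Mx hx] H; apply: special_sep Mx _ => J c EJ sp.
  case: (eqVneq (mdeg c) j) => cj.
    have cB : (mdeg c < B)%N by rewrite cj.
    have tP : (J, BMultinom cB) \in specials B k j by rewrite inE /= EJ cj sp !eqxx.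
    exact: H (Sub (J, BMultinom cB) tP : T).
  by move: (hx J); rewrite dE => /homog_ofP h; exact: dhomog_nemf_coeff h cj.
Qed.

End Koszul.

(** * Counting the special coordinates *)

Section Count.
Variables (n B : nat).
Local Notation pairs := ({set 'I_n} * 'X_{1..n < B})%type.

Lemma special_mdeg (J : {set 'I_n}) (c : 'X_{1..n}) : special J c -> (0 < mdeg c)%N.
Proof.
case/specialP => i /isfirst_gt0 ci _; rewrite lt0n mdeg_eq0; apply/negP => /eqP E.
by rewrite E mnm0E in ci.
Qed.

Lemma card_specials0 j : (j < B)%N -> (#|specials n B 0 j| + (j == 0) = hilb n j)%N.
Proof.
move=> jB; case: (eqVneq j 0%N) => j0 /=.
  rewrite j0 hilbn0 (_ : specials n B 0 0 = set0) ?cards0 //.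
  apply/setP => p; rewrite !inE; apply/negP => /and3P [_ /eqP E /special_mdeg].
  by rewrite E.
rewrite addn0 -(card_mdeg n jB).
rewrite -(card_imset _ (f := fun c : 'X_{1..n < B} => (set0 : {set 'I_n}, c))); last by move=> c c' [].
apply: eq_card => -[J c]; rewrite !inE /=; apply/and3P/imsetP => [[/eqP EJ Ec _]|[c' + [-> ->]]].
  by exists c => //; move/eqP: EJ; rewrite cards_eq0 => /eqP ->.
rewrite inE => Ec; split; rewrite ?cards0 //.
have [i ci] : exists i, (0 < c' i)%N by apply: mnm_pos_ex; rewrite (eqP Ec).
by have [i0 h] := isfirst_ex ci; apply/specialP; exists i0 => // l; rewrite inE.
Qed.

Lemma mdeg_sub_bound (c : 'X_{1..n < B}) i : (mdeg (bmnm c - U_(i)) < B)%N.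
Proof. exact: leq_ltn_trans (mdegB _ _) (bmdeg c). Qed.

(** Moves the first variable of [c] into [J]. This maps the special pairs bijectively to the
    nonspecial ones with [J] larger by one and the degree smaller by one; the inverse takes the
    minimum out of [J]. *)
Definition absorb_first (p : pairs) : pairs :=
  if [pick i | isfirst p.2 i] is Some i then (i |: p.1, BMultinom (mdeg_sub_bound p.2 i)) else p.

Lemma absorb_firstE (p : pairs) i : isfirst p.2 i ->
  absorb_first p = (i |: p.1, BMultinom (mdeg_sub_bound p.2 i)).
Proof.
move=> h; rewrite /absorb_first; case: pickP => [i' /(isfirst_uniq h) <- //|/(_ i)].
by rewrite h.
Qed.

Lemma absorb_first_inj k j : {in specials n B k j &, injective absorb_first}.
Proof.
move=> [J c] [J' c']; rewrite !inE /=.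
move=> /and3P [_ _ /specialP [i h HJ]] /and3P [_ _ /specialP [i' h' HJ']].
rewrite (absorb_firstE (p := (J, c)) h) (absorb_firstE (p := (J', c')) h') => E.
have EJ : i |: J = i' |: J' := congr1 fst E.
have Ec : (bmnm c - U_(i) = bmnm c' - U_(i'))%MM := congr1 (fun p : pairs => bmnm p.2) E.
have ii : i = i'.
  apply/eqP; apply/negPn/negP => ne.
  have : i \in i' |: J' by rewrite -EJ setU11.
  rewrite !inE (negbTE ne) /= => /HJ' lt1.
  have : i' \in i |: J by rewrite EJ setU11.
  rewrite !inE eq_sym (negbTE ne) /= => /HJ lt2.
  by have := ltn_trans lt1 lt2; rewrite ltnn.
subst i'; clear E.
have iJ : i \notin J by apply/negP => /HJ; rewrite ltnn.
have iJ' : i \notin J' by apply/negP => /HJ'; rewrite ltnn.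
congr pair; first by rewrite -(setU1K iJ) EJ setU1K.
by apply: val_inj; rewrite /= -(mnm_subU (isfirst_gt0 h)) Ec mnm_subU ?isfirst_gt0.
Qed.

Lemma absorb_first_image k j : (j.+1 < B)%N ->
  absorb_first @: specials n B k j.+1 =
  [set p : pairs | [&& #|p.1| == k.+1, mdeg p.2 == j & ~~ special p.1 p.2]].
Proof.
move=> jB; apply/setP => -[J c]; rewrite [in RHS]inE /=; apply/imsetP/idP.
  case=> [[J' c']]; rewrite inE /= => /and3P [/eqP EJ /eqP Ec /specialP [i h HJ]].
  rewrite (absorb_firstE (p := (J', c')) h) => E.
  have -> : J = i |: J' := congr1 fst E.
  have -> : bmnm c = (bmnm c' - U_(i))%MM := congr1 (fun p : pairs => bmnm p.2) E.
  have iJ : i \notin J' by apply/negP => /HJ; rewrite ltnn.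
  rewrite cardsU1 iJ EJ eqxx mdeg_subU ?isfirst_gt0 // Ec eqxx /=.
  apply/negP => /specialP [i1 h1 HJ1].
  have /HJ1 : i \in i |: J' by rewrite setU11.
  have : (0 < bmnm c' i1)%N by have := isfirst_gt0 h1; rewrite mnmBE; lia.
  by move/(isfirst_le h); rewrite leqNgt => /negbTE ->.
case/and3P => /eqP EJ /eqP Ec nsp.
have [j1 j1J] : exists j1, j1 \in J by apply/set0Pn; rewrite -card_gt0 EJ.
have [j0 j0J [Hmin Hc]] := nonspecial j1J nsp.
have dB : (mdeg (bmnm c + U_(j0)) < B)%N by rewrite mdegD mdeg1 Ec addn1.
have h : isfirst (bmnm c + U_(j0)) j0.
  rewrite /isfirst mnmDE mnm1E eqxx addn1 /=; apply/forallP => l; apply/implyP => lj.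
  rewrite mnmDE mnm1E; case: (eqVneq j0 l) => [E|_]; first by rewrite E ltnn in lj.
  by rewrite addn0 -leqn0 leqNgt; apply/negP => /Hc; rewrite leqNgt lj.
exists (J :\ j0, BMultinom dB).
  rewrite inE /= mdegD mdeg1 Ec addn1 eqxx /=; apply/andP; split.
    by have := cardsD1 j0 J; rewrite j0J EJ add1n => -[->].
  apply/specialP; exists j0 => // l; rewrite !inE => /andP [lj lJ].
  have := Hmin l lJ; rewrite leq_eqVlt => /orP [/eqP /val_inj E|//].
  by rewrite E eqxx in lj.
rewrite (absorb_firstE (p := (J :\ j0, BMultinom dB)) h) /= setD1K //; congr pair.
by apply: val_inj => /=; apply/mnmP => l; rewrite mnmBE mnmDE addnK.
Qed.

(** The nonspecial pairs at [(k + 1, j)] are the images of the special ones at [(k, j + 1)]. In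
    terms of series this is [H_k + H_(k+1) = C(n, k) T^k / (1 - T)^n], with the index shifted by
    one. *)
Lemma card_specialsS k j : (j.+1 < B)%N ->
  (#|specials n B k.+1 j| + #|specials n B k j.+1| = 'C(n, k.+1) * hilb n j)%N.
Proof.
move=> jB; rewrite -(card_in_imset (@absorb_first_inj k j.+1)) absorb_first_image //.
have -> : ('C(n, k.+1) * hilb n j)%N =
  #|[set p : pairs | (#|p.1| == k.+1) && (mdeg p.2 == j)]|.
  have -> : [set p : pairs | (#|p.1| == k.+1) && (mdeg p.2 == j)] =
      setX [set J : {set 'I_n} | #|J| == k.+1] [set c : 'X_{1..n < B} | mdeg c == j].
    by apply/setP => p; rewrite !inE.
  by rewrite cardsX card_draws card_ord cardsE card_mdeg // ltnW.
rewrite -[RHS](cardsID [set p : pairs | special p.1 p.2]); congr (_ + _)%N; apply: eq_card => p.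
  by rewrite !inE andbA.
by rewrite !inE andbA andbC.
Qed.

Lemma card_specials k j : (k + j < B)%N -> (#|specials n B k j|)%:Z = kcoef n n k.+1 (k + j).
Proof.
elim: k j => [|k IH] j kB.
  rewrite add0n /= subnn /kterm bin0 mul1n /hilb_shift /= subn0 -card_specials0 //.
  rewrite PoszD; case: j kB => [|j] _ /=; first by rewrite bin0 expr0 mul1r addrK.
  by rewrite bin0n /= mulr0 subr0 addr0.
have E := card_specialsS k (j := j); rewrite addSnnS /= -/(kcoef n n k.+1 _) -IH; last by lia.
rewrite /kterm /hilb_shift (_ : (k.+1 <= k + j.+1)%N); last by lia.
rewrite (_ : (k + j.+1 - k.+1)%N = j); last by lia.
by rewrite -E; [rewrite PoszD addrK|lia].
Qed.

End Count.

(** * Hilbert decompositions as lists of dimensions and shifts *)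

Lemma kcoef_diag n k : kcoef n n k.+1 k = 0.
Proof.
have kB : (k + 0 < k.+1)%N by rewrite addn0.
rewrite -{2}(addn0 k) -(card_specials n kB) (_ : specials _ _ _ 0 = set0) ?cards0 //.
by apply/setP => p; rewrite !inE; apply/negP => /and3P [_ /eqP E /special_mdeg]; rewrite E.
Qed.

Lemma kcoef_low n k e : (e <= k)%N -> kcoef n n k.+1 e = 0.
Proof.
elim: k => [|k IH]; rewrite leq_eqVlt => /orP [/eqP ->|]; rewrite ?kcoef_diag //.
rewrite ltnS => ek; rewrite /= -/(kcoef n n k.+1 e) IH // subr0.
by rewrite /kterm /hilb_shift leqNgt ltnS ek /= muln0.
Qed.

Lemma inM_deg_neg (K : fieldType) n k (d : int) (x : wedge K n) : d < k%:Z ->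
  inM_deg k.+1 d x <-> x = 0.
Proof.
move=> dk; split=> [[_ H]|->]; last first.
  by split; [exact: inM0|move=> J; rewrite ffunE; left].
apply/ffunP => J; rewrite [RHS]ffunE; case: (H J) => // -[j E _].
have Ed : d = j%:Z + k%:Z by rewrite -E subrK.
by move: dk; rewrite Ed; lia.
Qed.

Lemma inM_dim (K : fieldType) n k (e : nat) :
  exists2 m, has_dim (inM_deg (K := K) (n := n) k.+1 e%:Z) m & m%:Z = kcoef n n k.+1 e.
Proof.
case: (ltnP e k) => ek.
  exists 0%N; last by rewrite kcoef_low // ltnW.
  by apply: has_dim0 => x; apply: inM_deg_neg; rewrite ltz_nat.
exists #|specials n e.+1 k (e - k)|; last by rewrite card_specials ?subnKC.
by rewrite -[in e%:Z](subnKC ek); apply: inM_has_dim; lia.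
Qed.

Lemma Hdec_to_list (K : fieldType) n k dep : Hdec_depth_ge K n k.+1 dep ->
  exists l : seq (nat * nat), all (fun p => dep <= p.1 <= n)%N l /\
    forall e, kcoef n n k.+1 e = \sum_(p <- l) (hilb_shift p.1 p.2 e)%:Z.
Proof.
case=> N [r [A [s [Hdep [phi Hphi]]]]].
(* A summand with negative shift would contain the constant 1 in degree [s i], where [M(n, k + 1)]
   vanishes. *)
have s0 i : 0 <= s i.
  rewrite leNgt; apply/negP => si.
  have [lin [_ [_ onto]]] := Hphi (s i).
  pose z : {ffun 'I_N -> {mpoly K[n]}} := [ffun j => if j == i then 1 else 0].
  have [|x] := onto z.
    move=> j; rewrite ffunE; case: eqP => [->|_]; last by left.
    right; exists 0%N; first by rewrite subrr.
    exists [ffun=> 1]; rewrite (bigD1 [tuple]) //= ffunE scale1r big_ord0 big1 ?addr0 // => t.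
    by move/eqP => tn; case: tn; exact: tuple0.
  have dk : s i < k%:Z by apply: lt_le_trans si _.
  move/(inM_deg_neg x dk) => -> E.
  have z0 : phi (s i) 0 = 0.
    by apply: (@linear_on0 K _ _ (inM_deg k.+1 (s i))); [exact: lin|apply/inM_deg_neg].
  have : z i = 0 by rewrite -E z0 ffunE.
  by rewrite ffunE eqxx => /eqP; rewrite oner_eq0.
exists [seq (\rank (A i), `|s i|%N) | i : 'I_N]; split.
  by apply/allP => p /mapP [i _ ->] /=; rewrite [(dep <= _)%N]Hdep rank_leq_col.
move=> e; have [m hm <-] := inM_dim K n k e.
have [lin [into [inj onto]]] := Hphi e%:Z.
have h1 := has_dim_map lin into inj onto hm.
have h2 : has_dim (fun z : {ffun 'I_N -> {mpoly K[n]}} =>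
    forall i, in_retract_deg (A i) (e%:Z - s i) (z i)) (\sum_i hilb_shift (\rank (A i)) `|s i| e)%N.
  apply: (@has_dim_prod K _ N (fun i x => in_retract_deg (A i) (e%:Z - s i) x)) => i.
  by rewrite -{1}(gez0_abs (s0 i)); exact: retract_has_dim.
rewrite (has_dim_uniq h1 h2) big_map big_enum /=.
by rewrite (big_morph Posz PoszD (erefl _)).
Qed.

(** The retract on the first [p.1] variables realises the pair [p]. Equal dimensions give an
    isomorphism, chosen in each degree separately. *)
Lemma list_to_Hdec (K : fieldType) n k dep (l : seq (nat * nat)) :
  all (fun p => dep <= p.1 <= n)%N l ->
  (forall e, kcoef n n k.+1 e = \sum_(p <- l) (hilb_shift p.1 p.2 e)%:Z) ->
  Hdec_depth_ge K n k.+1 dep.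
Proof.
move=> al H; pose q (i : 'I_(size l)) := tnth (in_tuple l) i.
have qP i : (dep <= (q i).1 <= n)%N by apply: (allP al); exact: mem_tnth.
pose A (i : 'I_(size l)) : 'M[K]_((q i).1, n) := pid_mx (q i).1.
have rA i : \rank (A i) = (q i).1.
  by rewrite rank_pid_mx //; case/andP: (qP i).
exists (size l), (fun i => (q i).1), A, (fun i => (q i).2%:Z); split.
  by move=> i; rewrite /retract_dim rA; case/andP: (qP i).
pose Q (d : int) (z : {ffun 'I_(size l) -> {mpoly K[n]}}) :=
  forall i, in_retract_deg (A i) (d - (q i).2%:Z) (z i).
have dims d : exists m, has_dim (inM_deg (K := K) (n := n) k.+1 d) m /\ has_dim (Q d) m.
  case: d => e.
    have [m hm Em] := inM_dim K n k e; exists m; split=> //.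
    have -> : m = (\sum_i hilb_shift (\rank (A i)) (q i).2 e)%N.
      suff [] : m%:Z = (\sum_i hilb_shift (\rank (A i)) (q i).2 e)%N%:Z by [].
      rewrite Em H [RHS](big_morph Posz PoszD (erefl _)) [LHS]big_tnth.
      by apply: eq_bigr => i _; rewrite rA.
    apply: (@has_dim_prod K _ _ (fun i x => in_retract_deg (A i) (e%:Z - (q i).2%:Z) x)) => i.
    exact: retract_has_dim.
  exists 0%N; split; apply: has_dim0 => x; first by apply: inM_deg_neg; rewrite NegzE; lia.
  split=> [Hx|->]; last by move=> i; rewrite ffunE; left.
  apply/ffunP => i; rewrite [RHS]ffunE.
  have neg : Negz e - (q i).2%:Z < 0 by rewrite NegzE; lia.
  by have /(retract_neg (A i) _ neg) := Hx i.
have phis d : exists phi, [/\ linear_on (inM_deg (K := K) (n := n) k.+1 d) phi,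
    forall x, inM_deg k.+1 d x -> Q d (phi x),
    forall x y, inM_deg k.+1 d x -> inM_deg k.+1 d y -> phi x = phi y -> x = y &
    forall z, Q d z -> exists2 x, inM_deg k.+1 d x & phi x = z].
  by have [m [h1 h2]] := dims d; exact: has_dim_iso h1 h2.
exists (fun d => proj1_sig (constructive_indefinite_description _ (phis d))) => d.
by have [] := proj2_sig (constructive_indefinite_description _ (phis d)).
Qed.

(** * Asymptotics *)

Local Open Scope R_scope.

Lemma INR_expn x m : INR (x ^ m)%N = INR x ^ m.
Proof. by elim: m => //= m IH; rewrite expnS mult_INR IH. Qed.

Lemma INR_leq a b : (a <= b)%N -> INR a <= INR b.
Proof. by move=> h; apply: le_INR; lia. Qed.

Lemma INR_leq_inv a b : INR a <= INR b -> (a <= b)%N.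
Proof. by move=> /INR_le h; lia. Qed.

Lemma INR_expn_self x : INR (x ^ x)%N = exp (xlnx (INR x)).
Proof.
rewrite INR_expn; case: x => [|x]; first by rewrite /= xlnx_0 exp_0.
have p : 0 < INR x.+1 by apply: lt_0_INR; lia.
by rewrite xlnx_pos // -(Rpower_pow x.+1 (INR x.+1) p).
Qed.

Lemma INR_bin_ub b c :
  INR 'C(b + c, b) <= exp (xlnx (INR b + INR c) - xlnx (INR b) - xlnx (INR c)).
Proof.
have := INR_leq (bin_entropy_ub b c).
rewrite !mult_INR !INR_expn_self plus_INR => H.
have pb := exp_pos (xlnx (INR b)); have pc := exp_pos (xlnx (INR c)).
apply: (Rmult_le_reg_r (exp (xlnx (INR b)) * exp (xlnx (INR c)))); first exact: Rmult_lt_0_compat.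
by rewrite exp_sub_mul.
Qed.

Lemma INR_bin_lb b c :
  exp (xlnx (INR b + INR c) - xlnx (INR b) - xlnx (INR c))
    <= (INR b + INR c + 1) * INR 'C(b + c, b).
Proof.
have := INR_leq (bin_entropy_lb b c).
rewrite !mult_INR !INR_expn_self S_INR plus_INR => H.
have pb := exp_pos (xlnx (INR b)); have pc := exp_pos (xlnx (INR c)).
apply: (Rmult_le_reg_r (exp (xlnx (INR b)) * exp (xlnx (INR c)))); first exact: Rmult_lt_0_compat.
by rewrite exp_sub_mul Rmult_assoc.
Qed.

Lemma INR_subn a b : (b <= a)%N -> INR (a - b)%N = INR a - INR b.
Proof. by move=> ba; rewrite -minus_INR //; lia. Qed.

Lemma INR_bin_ub_sub a b : (b <= a)%N ->
  INR 'C(a, b) <= exp (xlnx (INR a) - xlnx (INR b) - xlnx (INR a - INR b)).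
Proof.
move=> ba; have := INR_bin_ub b (a - b); rewrite subnKC // INR_subn //.
by rewrite (_ : INR b + (INR a - INR b) = INR a) //; lra.
Qed.

Lemma INR_bin_lb_sub a b : (b <= a)%N ->
  exp (xlnx (INR a) - xlnx (INR b) - xlnx (INR a - INR b)) <= (INR a + 1) * INR 'C(a, b).
Proof.
move=> ba; have := INR_bin_lb b (a - b); rewrite subnKC // INR_subn //.
by rewrite (_ : INR b + (INR a - INR b) = INR a) //; lra.
Qed.

(** * Binomial quotients and the rate *)

Section RateBounds.
Variables n m k g : nat.
Hypotheses (n0 : (0 < n)%N) (Hs : (m + k + g <= n)%N).
Let rt := rate (INR m / INR n) (INR k / INR n) (INR g / INR n).

Lemma bin_rateE :
  (xlnx (INR n) - xlnx (INR k) - xlnx (INR n - INR k))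
  + (xlnx (INR (m + g)%N) - xlnx (INR m) - xlnx (INR (m + g)%N - INR m))
  - (xlnx (INR (n - g)%N) - xlnx (INR (m + k)%N) - xlnx (INR (n - g)%N - INR (m + k)%N))
  = INR n * rt.
Proof.
have pn : 0 < INR n by apply: lt_0_INR; lia.
have H := INR_leq Hs; rewrite !plus_INR in H.
rewrite INR_subn ?plus_INR; last by lia.
rewrite /rt -rate_scale //; try exact: pos_INR.
by rewrite (_ : INR m + INR g - INR m = INR g) //; lra.
Qed.

(** The factor [n + 1] stems from the lower entropy bound for [C(n - g, m + k)]. *)
Lemma bin_rate_ub :
  INR 'C(n, k) * INR 'C(m + g, m) <= (INR n + 1) * exp (INR n * rt) * INR 'C(n - g, m + k).
Proof.
have h1 : (k <= n)%N by lia. have h2 : (m <= m + g)%N by lia.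
have h3 : (m + k <= n - g)%N by lia.
have H1 := INR_bin_ub_sub h1; have H2 := INR_bin_ub_sub h2; have H3 := INR_bin_lb_sub h3.
move: bin_rateE H1 H2 H3; set x := _ - _ - _; set y := _ - _ - _; set z := _ - _ - _.
move=> <- H1 H2 H3.
have p1 := pos_INR 'C(n, k); have p2 := pos_INR 'C(m + g, m).
have H12 := Rmult_le_compat _ _ _ _ p1 p2 H1 H2.
apply: Rle_trans H12 _; rewrite -exp_plus.
rewrite -[exp (x + y)](exp_sub_mul _ z 0) exp_0 Rmult_1_r Rminus_0_r.
have pe := exp_pos (x + y - z).
have H3' : exp z <= (INR n + 1) * INR 'C(n - g, m + k).
  apply: Rle_trans H3 _; apply: Rmult_le_compat_r; first exact: pos_INR.
  have hh : INR (n - g)%N <= INR n by apply: INR_leq; lia.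
  lra.
have := Rmult_le_compat_l _ _ _ (Rlt_le _ _ pe) H3'; lra.
Qed.

(** Here two lower entropy bounds are used, hence the square. *)
Lemma bin_rate_lb :
  exp (INR n * rt) * INR 'C(n - g, m + k) <= (INR n + 1) ^ 2 * (INR 'C(n, k) * INR 'C(m + g, m)).
Proof.
have h1 : (k <= n)%N by lia. have h2 : (m <= m + g)%N by lia.
have h3 : (m + k <= n - g)%N by lia.
have H1 := INR_bin_lb_sub h1; have H2 := INR_bin_lb_sub h2; have H3 := INR_bin_ub_sub h3.
move: bin_rateE H1 H2 H3; set x := _ - _ - _; set y := _ - _ - _; set z := _ - _ - _.
move=> <- H1 H2 H3.
have H2' : exp y <= (INR n + 1) * INR 'C(m + g, m).
  apply: Rle_trans H2 _; apply: Rmult_le_compat_r; first exact: pos_INR.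
  have hh : INR (m + g)%N <= INR n by apply: INR_leq; lia.
  lra.
have H12 := Rmult_le_compat _ _ _ _ (Rlt_le _ _ (exp_pos x)) (Rlt_le _ _ (exp_pos y)) H1 H2'.
have := Rmult_le_compat_l _ _ _ (Rlt_le _ _ (exp_pos (x + y - z))) H3.
have := exp_sub_mul (x + y) z 0; rewrite exp_0 Rmult_1_r Rminus_0_r exp_plus => E.
move=> H; apply: Rle_trans H _; rewrite E; apply: Rle_trans H12 _; lra.
Qed.

End RateBounds.

(** A decomposition has a summand, because [M(n, k + 1)] is nonzero: for an empty list the
    coefficient [C(n, k + 1)] of [T^(k + 1)] in [(1 - T)^n H_(k+1)] would vanish. *)
Lemma Hdec_depth_le (K : fieldType) n k dep : (k.+1 <= n)%N ->
  Hdec_depth_ge K n k.+1 dep -> (dep <= n)%N.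
Proof.
move=> kn /Hdec_to_list [[|p l] [/= al H]]; last by case/andP: al => /andP [h1 h2] _; lia.
have := @kcoef_strip n n k.+1 [::] k.+1 (leqnn n) isT H.
rewrite subnn big_nil kcoef0_small // -signr_odd oddD addbb expr0 mul1r => /eqP.
by rewrite eqz_nat; have : (0 < 'C(n, k.+1))%N by [rewrite bin_gt0]; case: 'C(_, _).
Qed.

Lemma Hdec_kcoef_ge0 (K : fieldType) n k dep g e : (g <= n)%N -> (n - g <= dep)%N ->
  Hdec_depth_ge K n k.+1 dep -> (0 <= kcoef n g k.+1 e)%R.
Proof.
move=> gn gd /Hdec_to_list [l [al H]].
rewrite -(subKn gn) (@kcoef_strip n (n - g) k.+1 l e) ?leq_subr //; first exact: sumr_ge0.
by apply: sub_all al => p; lia.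
Qed.

Lemma eventually_ge (x : R) : exists N : nat, forall n, (N <= n)%N -> x <= INR n.
Proof.
have [N HN] := INR_unbounded x; exists N => n Nn.
by have := INR_leq Nn; lra.
Qed.

Lemma Rabs_le_intro x y d : x - y <= d -> y - x <= d -> Rabs (x - y) <= d.
Proof. by move=> h1 h2; apply: Rabs_le; lra. Qed.

Lemma Rabs_le_elim x y d : Rabs (x - y) <= d -> x - y <= d /\ y - x <= d.
Proof. by move=> h; have := Rle_abs (x - y); have := Rle_abs (- (x - y)); rewrite Rabs_Ropp; lra. Qed.

Lemma Rmin_pos_ex (x y z w : R) : 0 < x -> 0 < y -> 0 < z -> 0 < w ->
  exists d, 0 < d /\ d <= x /\ d <= y /\ d <= z /\ d <= w.
Proof.
move=> hx hy hz hw; exists (Rmin (Rmin x y) (Rmin z w)).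
have := Rmin_l (Rmin x y) (Rmin z w); have := Rmin_r (Rmin x y) (Rmin z w).
have := Rmin_l x y; have := Rmin_r x y; have := Rmin_l z w; have := Rmin_r z w.
have p : 0 < Rmin (Rmin x y) (Rmin z w) by repeat apply: Rmin_pos.
by move=> *; repeat split; lra.
Qed.

(** For even [m] the degree [m + k] has the parity of [kcoef_odd_bound]; with the entropy bounds, a
    nonnegative coefficient keeps the rate from being too negative. *)
Lemma negative_coef_bound (n k g m : nat) : (0 < n)%N -> (0 < g)%N -> (m + k + g <= n)%N ->
  (k < n)%N -> ~~ odd m -> (k.+1 * (m + g.-1) < (n - k) * m)%N ->
  (0 <= kcoef n g k.+1 (m + k))%R ->
  1 <= INR n * ((INR n + 1) *
     exp (INR n * rate (INR m / INR n) (INR k / INR n) (INR g / INR n))).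
Proof.
move=> n0 g0 Hs kn om Hr H0.
have ok : odd (k.+1 + (m + k)) by rewrite addnCA oddD addSn /= oddD addbb (negbTE om).
have Hr' : (k.+1 * (m + k - k + g.-1) < (n - k) * (m + k - k))%N by rewrite addnK.
have := kcoef_odd_bound g0 ok Hr' H0.
rewrite /kterm /hilb_shift leq_addl addnK => Hb.
have Hbin : (hilb g m <= 'C(m + g, m))%N by apply: leq_bin2l; lia.
have Hb2 : ('C(n - g, m + k) <= n * ('C(n, k) * 'C(m + g, m)))%N.
  by apply: leq_trans Hb _; apply: leq_mul => //; apply: leq_mul.
have := INR_leq Hb2; rewrite !mult_INR => H1.
have H2 := bin_rate_ub n0 Hs.
set E := exp _ in H2 *.
have pC : 0 < INR 'C(n - g, m + k).
  by apply: lt_0_INR; apply/ssrnat.ltP; rewrite bin_gt0; lia.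
apply: (Rmult_le_reg_r _ _ _ pC); rewrite Rmult_1_l.
apply: Rle_trans H1 _.
have := Rmult_le_compat_l _ _ _ (pos_INR n) H2; lra.
Qed.

(** If [gamma <= eps], the depth is at most [n]. Otherwise a depth above [(1 - g') n] with
    [g' = gamma - eps] makes all coefficients for [g] near [g' n] nonnegative, which fails near the
    degree [(a + beta) n] with [a] from [solution_below]. *)
Lemma depth_upper (beta gamma eps : R) (k : nat -> nat) :
  0 < beta -> beta <= / 2 -> is_solution beta gamma ->
  (forall n, (0 < k n)%N) -> lin_asym k beta -> 0 < eps ->
  exists N : nat, forall (K : fieldType) n, (N <= n)%N -> forall dep,
    Hdec_depth_ge K n (k n) dep -> INR dep <= (1 - gamma + eps) * INR n.
Proof.
move=> b0 b2 Hsol k0 kasym eps0.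
have [N1 HN1] := kasym (/ 4) ltac:(lra).
have kn n : (N1 < n)%N -> (k n <= n)%N.
  move=> hn; apply: INR_leq_inv; have h : (N1 <= n)%N by lia.
  have := Rabs_le_elim (HN1 n h); have := pos_INR n; nra.
have depn K n dep : (N1 < n)%N -> Hdec_depth_ge K n (k n) dep -> (dep <= n)%N.
  move=> hn; have := kn n hn; have := k0 n; case: (k n) => // k' _ kn'.
  exact: Hdec_depth_le.
case: (Rle_dec gamma eps) => [ge|/Rnot_le_lt lt].
  exists N1.+1 => K n hn dep hd; have := INR_leq (depn K n dep hn hd).
  have := pos_INR n; nra.
have [a [a0 [a1 [ac ar]]]] := solution_below _ _ (gamma - eps) b0 b2 Hsol ltac:(lra) ltac:(lra).
set g' := gamma - eps in a1 ac ar *.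
have bg := solution_le_half _ _ b0 b2 Hsol.
have [d0 [d0p Hu]] := rate_unif (- rate a beta g' / 2) ltac:(lra).
have [N0 [N01 HN0]] := cube_lt_exp (- rate a beta g' / 2) ltac:(lra).
set theta := (1 - beta) * a - beta * (a + g').
(* In turn: uniform continuity of the rate, the slack in [ratio_cond], and room for
   [m + k' + g <= n]; the last bound 1 only fills the fourth place. *)
have [d [dp [d1 [d2 [d3 d4]]]]] := @Rmin_pos_ex d0 (theta / 10) ((1 - a - beta - g') / 4) 1
   d0p ltac:(rewrite /theta; lra) ltac:(lra) ltac:(lra).
have [N2 HN2] := kasym (d / 2) ltac:(lra).
have [N3 HN3] := eventually_ge (2 / d).
have [N4 HN4] := eventually_ge N0.
exists (maxn N1.+1 (maxn N2 (maxn N3 N4))) => K n hn dep hdec.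
have n0 : (0 < n)%N by lia.
have h1 : (k n <= n)%N by apply: kn; lia.
have h2 := HN2 n ltac:(lia).
have h3 := HN3 n ltac:(lia).
have h4 := HN4 n ltac:(lia).
have pn : 0 < INR n by lra.
have dn : 2 <= d * INR n.
  have := Rmult_le_compat_l _ _ _ (Rlt_le _ _ dp) h3.
  by rewrite /Rdiv -Rmult_assoc (Rmult_comm d) Rmult_assoc Rinv_r; lra.
apply: Rnot_lt_le => hgt.
have g'n : 0 <= g' * INR n by apply: Rmult_le_pos; rewrite /g'; lra.
have an2 : 0 <= a * INR n / 2 by have := Rmult_lt_0_compat _ _ a0 pn; lra.
have [gf [gf1 gf2]] := nat_floor_ex _ g'n.
have [mf [mf1 mf2]] := nat_floor_ex _ an2.
(* Rounding up puts [n - g] below [(1 - g') n], hence below [dep]. *)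
set g := gf.+1.
have Eg : INR g = INR gf + 1 by rewrite S_INR.
(* The even number [2 * mf] differs from [a n] by less than 2, which [d * INR n] covers. *)
have [m [Em om]] : exists m, INR m = 2 * INR mf /\ ~~ odd m.
  by exists (2 * mf)%N; split; [rewrite mult_INR|rewrite oddM].
have := k0 n; case Ek : (k n) => [//|k'] _; rewrite Ek in h1 h2 hdec.
rewrite S_INR in h2; have [h2a h2b] := Rabs_le_elim h2.
have Hs : (m + k' + g <= n)%N.
  apply: INR_leq_inv; rewrite !plus_INR.
  have : d * INR n <= (1 - a - beta - g') / 4 * INR n by apply: Rmult_le_compat_r; lra.
  lra.
have gd : (n - g <= dep)%N.
  apply: INR_leq_inv; rewrite INR_subn; last by lia.
  by move: hgt gf2; rewrite Eg /g'; lra.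
have H0 := @Hdec_kcoef_ge0 K n k' dep g (m + k') ltac:(lia) gd hdec.
have Hr : (k'.+1 * (m + g.-1) < (n - k') * m)%N.
  have Hrr : INR k' + 1 = INR k'.+1 by rewrite S_INR.
  have := @ratio_cond beta a g' theta d (INR n) (INR k'.+1) (INR k') (INR m) (INR gf).
  have dpn := Rmult_lt_0_compat _ _ dp pn.
  move=> H; have {H} : INR k'.+1 * (INR m + INR gf) < (INR n - INR k') * INR m.
    apply: H => //; rewrite -?Hrr; try (split; lra); try lra.
    - by split; [lra|rewrite /g' in a1 *; lra].
    - by split; rewrite /g'; lra.
    - by split; [exact: pos_INR|lra].
  rewrite -INR_subn; last by lia.
  by rewrite -plus_INR -!mult_INR => /INR_lt; rewrite /g /=; lia.
have := negative_coef_bound n0 (ltn0Sn gf) Hs ltac:(lia) om Hr H0.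
apply: Rlt_not_le; apply: (@exp_neg_absurd _ _ (- rate a beta g' / 2)); [lra| |exact: HN0].
have Hsr := INR_leq Hs; rewrite !plus_INR in Hsr.
have : Rabs (rate (INR m / INR n) (INR k' / INR n) (INR g / INR n) - rate a beta g')
    < - rate a beta g' / 2.
  have dpn := Rmult_lt_0_compat _ _ dp pn.
  apply: Hu; try (apply: div_nonneg_le => //; exact: pos_INR); try lra; try (rewrite /g'; lra).
  - exact: div_sum_le1.
  - by apply: (Rle_trans _ _ _ _ d1); apply: div_close => //; apply: Rabs_le_intro; lra.
  - by apply: (Rle_trans _ _ _ _ d1); apply: div_close => //; apply: Rabs_le_intro; lra.
  - by apply: (Rle_trans _ _ _ _ d1); apply: div_close => //; apply: Rabs_le_intro; lra.
by rewrite /g => /Rlt_le /Rabs_le_elim [hh _]; lra.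
Qed.

(** Slightly above [gamma] the rate has a positive lower bound over all [a], so [t_(k-1)] is at
    least [n C(n - g, e)] in every degree [k < e <= n - g], all coefficients are nonnegative, and
    [kcoef_decomposition] applies. *)
Lemma depth_lower (beta gamma eps : R) (k : nat -> nat) :
  0 < beta -> beta <= / 2 -> is_solution beta gamma ->
  lin_asym k beta -> 0 < eps ->
  exists N : nat, forall (K : fieldType) n, (N <= n)%N ->
    exists dep, Hdec_depth_ge K n (k n) dep /\ (1 - gamma - eps) * INR n <= INR dep.
Proof.
move=> b0 b2 Hsol kasym eps0.
have bg := solution_le_half _ _ b0 b2 Hsol.
have g0 : 0 <= gamma by case: Hsol.
(* The cap [/ 4] gives [g <= (gamma + e) n <= 3 n / 4], since [gamma <= / 2]. *)
have [e [ep [e1 [e2 _]]]] := @Rmin_pos_ex eps (/ 4) 1 1 eps0 ltac:(lra) ltac:(lra) ltac:(lra).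
set g' := gamma + e / 2.
have Hab a : 0 <= a -> a + beta + g' <= 1 -> 0 < rate a beta g'.
  by apply: (solution_above beta gamma) => //; rewrite /g'; lra.
have [c [c0 Hc]] := rate_min_pos beta g' b0 ltac:(rewrite /g'; lra) Hab.
have [d [dp Hu]] := rate_unif (c / 2) ltac:(lra).
have [N0 [N01 HN0]] := cube_lt_exp (c / 2) ltac:(lra).
have [dd [ddp [dd1 [dd2 _]]]] := @Rmin_pos_ex (d / 4) (beta / 4) 1 1 ltac:(lra) ltac:(lra) ltac:(lra) ltac:(lra).
have [N2 HN2] := kasym dd ddp.
have [N3 HN3] := eventually_ge (4 / d + 4 / beta + 2 / e).
have [N4 HN4] := eventually_ge N0.
exists (maxn 1 (maxn N2 (maxn N3 N4))) => K n hn.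
have n0 : (0 < n)%N by lia.
have h2 := HN2 n ltac:(lia).
have h3 := HN3 n ltac:(lia).
have h4 := HN4 n ltac:(lia).
have pn : 0 < INR n by lra.
have inv_le x y z : 0 < x -> 0 <= z -> 0 <= y -> y / x + z <= INR n -> y <= x * INR n.
  move=> px pz py h.
  have : x * (y / x) <= x * INR n by apply: Rmult_le_compat_l; lra.
  by rewrite /Rdiv (Rmult_comm y) -Rmult_assoc Rinv_r; lra.
have q1 : 0 < 4 / d by apply: Rdiv_lt_0_compat; lra.
have q2 : 0 < 4 / beta by apply: Rdiv_lt_0_compat; lra.
have q3 : 0 < 2 / e by apply: Rdiv_lt_0_compat; lra.
have dn : 4 <= d * INR n by apply: (@inv_le d 4 0); lra.
have bn : 4 <= beta * INR n by apply: (@inv_le beta 4 0); lra.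
have en : 2 <= e * INR n by apply: (@inv_le e 2 0); lra.
have g'n : 0 <= g' * INR n by apply: Rmult_le_pos; rewrite /g'; lra.
have [gf [gf1 gf2]] := nat_floor_ex _ g'n.
(* With this offset [hilb g m] is exactly [C(m + gf, m)], so the rate is taken at [gf]. *)
set g := gf.+1.
have Eg : INR g = INR gf + 1 by rewrite S_INR.
have ddn : dd * INR n <= d / 4 * INR n by apply: Rmult_le_compat_r; lra.
have ddb : dd * INR n <= beta / 4 * INR n by apply: Rmult_le_compat_r; lra.
have [h2a h2b] := Rabs_le_elim h2.
have bn2 : beta * INR n <= / 2 * INR n by apply: Rmult_le_compat_r; lra.
have g'n2 : g' * INR n <= (gamma + e / 2) * INR n by rewrite /g'; lra.
have ge34 : (gamma + e) * INR n <= 3 / 4 * INR n by apply: Rmult_le_compat_r; lra.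
have gle : INR g <= (gamma + e) * INR n by rewrite Eg; lra.
have gn : (g <= n)%N by apply: INR_leq_inv; lra.
have k2 : (2 <= k n)%N by apply: INR_leq_inv => /=; lra.
have kn : (k n <= n)%N by apply: INR_leq_inv; lra.
exists (n - g)%N; split; last first.
  rewrite INR_subn //.
  have : e * INR n <= eps * INR n by apply: Rmult_le_compat_r; lra.
  lra.
move: k2 kn h2a h2b; case: (k n) => [//|[//|k'']] _ kn h2a h2b.
set k' := k''.+1 in kn h2a h2b *; rewrite S_INR in h2a h2b.
have [l [al Hl]] : exists l : seq (nat * nat), all (fun p => n - g <= p.1 <= n)%N l /\
    forall e, kcoef n n k'.+1 e = (\sum_(p <- l) (hilb_shift p.1 p.2 e)%:Z)%R.
  apply: kcoef_decomposition => // ee hee.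
  (* In degrees up to [k' + 1] the difference [ee - k'.+1] is 0 and the terms count as
     decreasing. *)
  case: (leqP ee k'.+1) => eek.
    suff /andP [] : ((0 <= kcoef n g k'.+1 ee)%R && (kcoef n g k'.+1 ee <= (kterm n g k'.+1 ee)%:Z)%R) by [].
    by apply: kcoef_drop_ge0 => //; rewrite (eqP (_ : ee - k'.+1 == 0)%N) ?muln0 // subn_eq0.
  apply: kcoef_ge0 => //; first by lia.
  have [m Em] : exists m, (ee = m + k')%N by exists (ee - k')%N; lia.
  have Hs : (m + k' + gf <= n)%N by lia.
  have E1 : kterm n g k''.+1 ee = ('C(n, k') * 'C(m + gf, m))%N.
    by rewrite /kterm /hilb_shift Em leq_addl addnK /hilb /g addnS.
  rewrite E1; apply: INR_leq_inv; rewrite !mult_INR.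
  have mono : INR 'C(n - g, ee) <= INR 'C(n - gf, m + k').
    by apply: INR_leq; rewrite Em; apply: leq_bin2l; lia.
  apply: (Rle_trans _ (INR n * INR 'C(n - gf, m + k'))).
    by apply: Rmult_le_compat_l => //; exact: pos_INR.
  have Hsr := INR_leq Hs; rewrite !plus_INR in Hsr.
  apply: (@exp_pos_dominates _ (rate (INR m / INR n) (INR k' / INR n) (INR gf / INR n)) (c / 2)).
  - lra.
  - apply: (@rate_lower beta g' c d) => //; try (rewrite /g'; lra).
    + by apply: div_nonneg_le => //; exact: pos_INR.
    + by apply: div_nonneg_le => //; exact: pos_INR.
    + by apply: div_nonneg_le => //; exact: pos_INR.
    + exact: div_sum_le1.
    + by apply: div_close => //; apply: Rabs_le_intro; lra.
    + by apply: div_close => //; apply: Rabs_le_intro; lra.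
  - exact: HN0.
  - exact: pos_INR.
  - by apply: Rmult_le_pos; exact: pos_INR.
  - exact: bin_rate_lb.
exact: list_to_Hdec al Hl.
Qed.

Theorem theorem4p5 :
  forall beta : R, 0 < beta -> beta <= / 2 ->
  exists gamma : R, smallest_solution beta gamma /\
    forall (K : fieldType) (k : nat -> nat),
      (forall n, (0 < k n)%N) -> lin_asym k beta ->
      Hdepth_asym K k gamma.
Proof.
move=> beta b0 b2; have [gamma Hs] := smallest_solution_ex beta b0 b2.
exists gamma; split=> // K k k0 kasym eps eps0; have [Hsol _] := Hs.
have [N1 H1] := depth_lower b0 b2 Hsol kasym eps0.
have [N2 H2] := depth_upper b0 b2 Hsol k0 kasym eps0.
exists (maxn N1 N2) => n hn; split.
  by apply: H1; lia.
by apply: H2; lia.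
Qed.
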